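(* Let $X$ be a spectrally positive Lévy process with $X_0=0$ and Laplace–Stieltjes exponent $\varphi$, and assume $\varphi'(0)>0$. Let $h$ be a non-negative Borel function on $[0,\infty)$, let $x>0$, and let $$A_x:=\int_0^{T_x}h(W^x_t-W_t)\,\mathrm{d}t .$$ Then for every $\alpha\geqslant 0$, $$\mathbb{E}\,e^{-\alpha A_x}=\exp\left(-\int_0^x\varphi^{-1}(\alpha h(y))\,\mathrm{d}y\right).$$
   Context: $X=\{X_t\}_{t\geqslant 0}$ is a spectrally positive Lévy process: a càdlàg process with stationary and independent increments, no negative jumps, $X_0=0$. Its exponent $\varphi:[0,\infty)\to\mathbb{R}$ is defined by $\mathbb{E}\,e^{-\alpha X_t}=e^{\varphi(\alpha)t}$ for $\alpha,t\geqslant 0$. We write $\varphi'(0)=\lim_{\alpha\downarrow 0}\varphi'(\alpha)$; one has $\mathbb{E}X_t=-\varphi'(0)t$. The standing assumption is $\varphi'(0)>0$; then $X$ is not a subordinator, $\varphi$ is a continuous strictly increasing bijection of $[0,\infty)$ onto itself, and $\varphi^{-1}:[0,\infty)\to[0,\infty)$ is its inverse. Hitting times: $T_x:=\inf\{t\geqslant 0\,|\,X_t<-x\}$ for $x\geqslant 0$ (a.s. finite under the standing assumption). Reflected process: $W_t=X_t+L_t$ with $L_t=-\inf_{0\leqslant s\leqslant t}X_s$. Process with secondary jump inputs, for $x>0$: $S^x_0=0$, $S^x_n=\inf\{t\,|\,X_t<-nx\}$ for $n\geqslant 1$, and $W^x_t=X_t+x\sum_{n=1}^\infty n\,1_{[S^x_{n-1},S^x_n)}(t)$.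 (In particular $W^x_t=x+X_t$ for $t\in[0,T_x)$.) The same driving process $X$ is used for $W$ and $W^x$. $A_x$ takes values in $[0,\infty]$; the conventions $e^{-\infty}=0$ and $0\cdot\infty=0$ are used. *)

(* Defs.v *)
From HB Require Import structures.
From mathcomp Require Import all_boot all_order all_algebra.
From mathcomp Require Import all_classical all_reals all_analysis.

Set Implicit Arguments.
Unset Strict Implicit.
Unset Printing Implicit Defensive.

Import Order.TTheory GRing.Theory Num.Theory.
Import numFieldNormedType.Exports.

Local Open Scope classical_set_scope.
Local Open Scope ring_scope.

(* A process is a family X : R -> {RV P >-> R}; only the times t >= 0 matter. *)

Section levy.
Context (d : measure_display) (Omega : measurableType d) (R : realType)
  (P : probability Omega R).

(* For random variables, the product rule over the full family already gives it
   for every subfamily: take B i = setT for the remaining indices. *)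
Definition mutually_independent (n : nat) (Y : 'I_n -> Omega -> R) : Prop :=
  forall B : 'I_n -> set R, (forall i, measurable (B i)) ->
    P (\bigcap_(i in [set: 'I_n]) (Y i @^-1` B i))
    = (\prod_(i < n) P (Y i @^-1` B i))%E.

Definition independent_increments (X : R -> {RV P >-> R}) : Prop :=
  forall (n : nat) (t : nat -> R),
    0 <= t 0%N -> (forall i, (i < n)%N -> t i < t i.+1) ->
    @mutually_independent n (fun i => X (t i.+1) \- X (t i)).

Definition stationary_increments (X : R -> {RV P >-> R}) : Prop :=
  forall s t : R, 0 <= s -> 0 <= t ->
  forall B : set R, measurable B ->
    pushforward P (X (s + t) \- X s) B = pushforward P (X t \- X 0) B.

Definition cadlag (f : R -> R) : Prop :=
  (forall t, 0 <= t -> f s @[s --> t^'+] --> f t) /\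
  (forall t, 0 < t -> exists l : R, f s @[s --> t^'-] --> l).

Definition no_negative_jumps (f : R -> R) : Prop :=
  forall t l : R, 0 < t -> f s @[s --> t^'-] --> l -> l <= f t.

Record spectrally_positive_levy (X : R -> {RV P >-> R}) : Prop := {
  levy_start : forall w, X 0 w = 0 ;
  levy_cadlag : forall w, cadlag (X ^~ w) ;
  levy_no_negative_jumps : forall w, no_negative_jumps (X ^~ w) ;
  levy_independent_increments : independent_increments X ;
  levy_stationary_increments : stationary_increments X
}.

Definition laplace_exponent (X : R -> {RV P >-> R}) (phi : R -> R) : Prop :=
  forall alpha t : R, 0 <= alpha -> 0 <= t ->
    'E_P[fun w => expR (- alpha * X t w)]%E = (expR (phi alpha * t))%:E.

End levy.

Section path_functionals.
Context (R : realType).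

Definition hitting_time (f : R -> R) (x : R) : \bar R :=
  ereal_inf [set t%:E | t in [set t : R | 0 <= t /\ f t < - x]].

Definition regulator (f : R -> R) (t : R) : R :=
  - inf [set f s | s in `[0, t]].

Definition reflected (f : R -> R) (t : R) : R := f t + regulator f t.

Definition jump_epoch (f : R -> R) (x : R) (n : nat) : \bar R :=
  if n is 0 then 0%E else hitting_time f (n%:R * x).

(* The intervals [S_(n-1), S_n[ are pairwise disjoint, so at every t the series
   has at most one nonzero term. *)
Definition secondary_jump (f : R -> R) (x t : R) : R :=
  f t + x * limn (fun N => (\sum_(1 <= n < N)
    n%:R * \1_(`[jump_epoch f x n.-1, jump_epoch f x n[ : set (\bar R)) t%:E)%R : R).

Definition area (h f : R -> R) (x : R) : \bar R :=
  \int[lebesgue_measure]_(t in [set t : R | (0 <= t%:E < hitting_time f x)%E])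
    (h (secondary_jump f x t - reflected f t))%:E.

(* Inverse on [0, +oo[; on the image of [0, +oo[ under phi it is a right
   inverse of phi taking values in [0, +oo[, and it is 0 off that image. *)
Definition exponent_inv (phi : R -> R) : R -> R :=
  'pinv_(fun=> 0) `[0, +oo[ phi.

End path_functionals.

(* Main.v *)
Require Import Defs.
From HB Require Import structures.
From mathcomp Require Import all_boot all_order all_algebra.
From mathcomp Require Import all_classical all_reals all_analysis.
From mathcomp Require Import measurable_realfun.
From mathcomp Require Import ring lra.

Set Implicit Arguments.
Unset Strict Implicit.
Unset Printing Implicit Defensive.

Import Order.TTheory GRing.Theory Num.Theory.
Import numFieldNormedType.Exports.

Local Open Scope classical_set_scope.
Local Open Scope ring_scope.

(** Write [L_t = - inf_(s <= t) X_s] for the regulator, so that [W = X + L],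
    and [T_y] for the first passage time below [-y].  Before [T_x] the
    secondary jumps give [W^x = X + x], hence [W^x - W = x - L], and up to a
    single instant [{t < T_x} = {L_t <= x}].  Therefore [alpha * A_x] is the
    integral over all times of [phi (theta (L_s))], where
    [theta y = phi^-1 (alpha * h (x - y))] on [[0, x]] and [theta y = 0]
    elsewhere ([area_occupation]), and the theorem is an instance of
    [[
      E exp (- int_0^oo phi (theta (L_s)) ds) = exp (- int_0^oo theta (y) dy),
    ]]
    the Laplace functional of the random measure [dT_y] ([laplace_functional]).

    For a continuous [theta] of compact support the formula comes from one
    martingale.  With predictable weights [theta (L_s)], the exponential of
    [- int theta (L) dX - int phi (theta (L)) ds] has mean one.  Since [X] has
    no negative jumps, [L] is continuous and increases only while [X + L = 0],
    so integrating by parts turns this exponential into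
    [[
      Z_t = exp (- theta (L_t) (X_t + L_t) + int_0^(L_t) theta (y) dy
                 - int_0^t phi (theta (L_s)) ds).
    ]]
    [Z] is bounded, and [L_t] leaves the support of [theta] almost surely, so
    that letting [t] tend to infinity in [E Z_t = 1] gives the formula
    ([laplace_functional_compact]).  That [L_t] is unbounded follows from
    [E Z_t = 1] for trapezoidal weights and the positivity of [phi] off 0
    ([regulator_unbounded]), which convexity and the positive derivative at 0
    give ([exponent_growth]).

    The identity [E Z_t = 1] is obtained from grids ([regulated_mean]).  There
    the analogue of [Z] is a finite product whose mean is one because each
    increment is independent of the past ([exponential_martingale]), the
    integration by parts is an identity between finite sums
    ([skeleton_summation_by_parts]), and the passage to the limit is pathwise
    ([skeleton_exponent_cvg]): it rests on the uniform lower modulus of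
    continuity of a path without negative jumps ([lower_modulus]).  Doubling
    [theta] bounds the second moments, which makes the means converge
    ([square_bounded_cvg_integral]).

    The formula extends to Borel [theta] in two steps.  A bounded [theta]
    coincides with a continuous function off an open set of small Lebesgue
    measure (Lusin and Tietze), and the formula for continuous functions
    increasing to the indicator of that open set shows that [dT] seldom charges
    it ([mean_damp_open], [mean_damp_close]).  An unbounded [theta] is the
    increasing limit of its truncations. *)

(** * The Laplace exponent and its inverse *)

Section laplace_exponent_theory.
Context (d : measure_display) (Omega : measurableType d) (R : realType)
  (P : probability Omega R) (Z : Omega -> R) (phi : R -> R).
Hypothesis mZ : measurable_fun setT Z.
Hypothesis hphi : forall a : R, 0 <= a ->
  (\int[P]_w (expR (- a * Z w))%:E = (expR (phi a))%:E)%E.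

Lemma measurable_expRM (a : R) : measurable_fun setT (fun w => expR (a * Z w)).
Proof.
by apply: measurableT_comp => //; exact: measurable_funM.
Qed.

Lemma exponent_eq0 : phi 0 = 0.
Proof.
have := hphi (lexx 0).
under eq_integral do rewrite oppr0 mul0r expR0.
rewrite integral_cst//= probability_setT mule1 => -[] /esym/eqP.
by rewrite -expR0 => /eqP/expR_inj.
Qed.

(** The exponential is convex; applied under the expectation to the
    normalized weights [exp (- a Z - phi a)], which have mean one, this gives
    [exp (phi v - s phi u - (1 - s) phi w) <= 1] for [v = s u + (1 - s) w].
    The inequality is multiplied out by [w - u]. *)
Lemma exponent_convex (u v w : R) : 0 <= u -> u < v -> v < w ->
  (w - u) * phi v <= (w - v) * phi u + (v - u) * phi w.
Proof.
move=> u0 uv vw.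
have uw : 0 < w - u by lra.
pose s := (w - v) / (w - u).
have s0 : 0 <= s by rewrite divr_ge0 ?ltW// subr_gt0.
have s1 : s <= 1 by rewrite ler_pdivrMr// mul1r; lra.
have vE : v = s * u + (1 - s) * w by rewrite /s; field; lra.
pose c := s * phi u + (1 - s) * phi w.
suff : phi v <= c.
  rewrite -(ler_pM2l uw) => /le_trans; apply.
  by rewrite /c /s le_eqVlt; apply/orP; left; apply/eqP; field; lra.
have key : ((expR (- c))%:E * (expR (phi v))%:E <= 1)%E.
  rewrite -hphi; last lra.
  rewrite -ge0_integralZl_EFin ?expR_ge0//=; last first.
    by apply/measurable_EFinP; exact: measurable_expRM.
  pose g (a : R) x := (expR (- phi a) * expR (- a * Z x)).
  have mg a : measurable_fun setT (g a).
    by apply: measurable_funM => //; exact: measurable_expRM.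
  have g0 a x : 0 <= g a x by rewrite mulr_ge0 ?expR_ge0.
  have ig a : 0 <= a -> (\int[P]_x (g a x)%:E = 1)%E.
    move=> a0; rewrite /g.
    under eq_integral do rewrite EFinM.
    rewrite ge0_integralZl_EFin ?expR_ge0//=; last first.
    by apply/measurable_EFinP; exact: measurable_expRM.
    by rewrite hphi// -EFinM -expRD addNr expR0.
  have s1' : 0 <= 1 - s by lra.
  apply: (@le_trans _ _ (\int[P]_x ((s * g u x)%:E + ((1 - s) * g w x)%:E))%E).
    apply: ge0_le_integral => //.
    - by apply/measurable_EFinP; apply: measurable_funM => //; exact: measurable_expRM.
    - by apply/measurable_EFinP; apply: measurable_funD; exact: measurable_funM.
    move=> x _; rewrite -EFinM -EFinD lee_fin /g -!expRD.
    have := @convex_expR R (Itv01 s0 s1) (- phi u + - u * Z x) (- phi w + - w * Z x).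
    rewrite !convRE /= => h; apply: le_trans h.
    by rewrite ler_expR /c {1}vE /unstable.onem; lra.
  rewrite ge0_integralD; first last => //.
    - by apply/measurable_EFinP; exact: measurable_funM.
    - by move=> x _; rewrite lee_fin mulr_ge0.
    - by apply/measurable_EFinP; exact: measurable_funM.
    - by move=> x _; rewrite lee_fin mulr_ge0.
  under eq_integral do rewrite EFinM.
  under [X in (_ + X)%E]eq_integral do rewrite EFinM.
  rewrite !ge0_integralZl_EFin//; last 4 first.
    - by move=> x _; rewrite lee_fin.
    - exact/measurable_EFinP.
    - by move=> x _; rewrite lee_fin.
    - exact/measurable_EFinP.
  rewrite !ig; [|lra|lra].
  by rewrite !mule1 -EFinD lee_fin; lra.
move: key; rewrite -EFinM lee_fin -expRD.
by rewrite -[leRHS]expR0 ler_expR; lra.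
Qed.

(** Dominated convergence, with the bound [1 + exp (- Z)].  Convexity alone
    would leave room for a downward jump of [phi] at 0. *)
Lemma exponent_right_continuous0 : phi n.+1%:R^-1 @[n --> \oo] --> 0.
Proof.
pose f (n : nat) w := (expR (- n.+1%:R^-1 * Z w))%:E.
have /= := @dominated_convergence _ _ _ P setT measurableT f (cst 1%E)
  (fun w => (1 + expR (- 1 * Z w))%:E).
case.
- by move=> n; apply/measurable_EFinP; exact: measurable_expRM.
- exact: measurable_cst.
- apply: aeW => w _ /=; apply/fine_cvgP; split; first exact: nearW.
  have h0 : (- n.+1%:R^-1 * Z w) @[n --> \oo] --> (0 : R).
    rewrite -(mul0r (Z w)) -[X in X * _]oppr0.
    by apply: cvgMl; apply: cvgN; exact: cvg_harmonic.
  have := cvg_comp _ _ h0 (@continuous_expR R 0); rewrite expR0; exact.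
- apply/integrableP; split.
    by apply/measurable_EFinP; apply: measurable_funD => //; exact: measurable_expRM.
  under eq_integral do rewrite /= ger0_norm ?addr_ge0 ?expR_ge0// EFinD.
  rewrite ge0_integralD//=; last first.
    by apply/measurable_EFinP; exact: measurable_expRM.
  by rewrite hphi// integral_cst//= probability_setT mule1 -EFinD ltry.
- apply: aeW => w n _; rewrite /f /= lee_fin ger0_norm ?expR_ge0//.
  have [z0|z0] := leP 0 (Z w).
    rewrite (@le_trans _ _ 1)// ?lerDl ?expR_ge0//.
    by rewrite -[leRHS]expR0 ler_expR mulNr oppr_le0 mulr_ge0.
  rewrite (@le_trans _ _ (expR (-1 * Z w)))// ?lerDr//.
  rewrite ler_expR !mulNr lerN2 mul1r -[leLHS]mul1r ler_nM2r//.
  by rewrite invf_le1// ler1n.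
move=> _ _.
rewrite integral_cst//= probability_setT mule1.
rewrite [X in X @ _ --> _](_ : _ = EFin \o (fun n => expR (phi n.+1%:R^-1))); last first.
  by apply/funext => n /=; rewrite hphi.
move/fine_cvgP => [_ /=].
rewrite (_ : fine \o _ = (fun n => expR (phi n.+1%:R^-1))); last by [].
move=> h.
have := cvg_comp _ _ h (@continuous_ln R 1 ltr01).
rewrite ln1; apply: cvg_trans; apply: near_eq_cvg; apply: nearW => n /=.
by rewrite expRK.
Qed.

(** Close to 0 the mean value theorem bounds the slopes of [phi] below by
    [dphi0 / 2], and by convexity slopes only increase from there on. *)
Lemma exponent_growth (dphi0 : R) :
  phi^`()%classic a @[a --> 0^'+] --> dphi0 -> 0 < dphi0 ->
  exists2 c, 0 < c & forall a b, 0 <= a -> a <= b -> c * (b - a) <= phi b - phi a.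
Proof.
move=> hd d0; pose c := dphi0 / 2; have c0 : 0 < c by rewrite /c divr_gt0.
have : \forall a \near 0^'+, c < phi^`()%classic a.
  by apply: (cvgr_gt _ hd); rewrite /c; lra.
case=> eta /= eta0 hder.
have der a : 0 < a < eta -> derivable phi a 1 /\ c < phi^`()%classic a.
  move=> /andP[a0 ae].
  have h : c < phi^`()%classic a.
    by apply: hder => //=; rewrite sub0r normrN gtr0_norm.
  split => //.
  (* Where the difference quotient diverges, its [lim] is the default value 0,
     which is below [c]. *)
  apply: contrapT => /dvgP h0; move: h; rewrite derive1E /derive h0.
  by rewrite ltNge (ltW c0).
have local a b : 0 < a -> a < b -> b < eta -> c * (b - a) <= phi b - phi a.
  move=> a0 ab be.
  have dab t : a <= t <= b -> derivable phi t 1 /\ c < phi^`()%classic t.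
    by move=> /andP[? ?]; apply: der; apply/andP; split; lra.
  have hder' t : t \in `]a, b[ -> is_derive t 1 phi (phi^`()%classic t).
    rewrite in_itv/= => /andP[at_ tb].
    have [h _] := dab t ltac:(by rewrite !ltW).
    by rewrite derive1E; apply: DeriveDef.
  have hcont : {within `[a, b], continuous phi}.
    by apply: derivable_within_continuous => t; rewrite in_itv/= => /dab[].
  have [t] := MVT ab hder' hcont; rewrite in_itv/= => /andP[at_ tb] ->.
  rewrite ler_pM2r ?subr_gt0//.
  by have [_ /ltW] := dab t ltac:(by rewrite !ltW).
have local0 b : 0 <= b -> b < eta -> c * b <= phi b.
  rewrite le_eqVlt => /orP[/eqP<- _|b0 be]; first by rewrite mulr0 exponent_eq0.
  have h1 : (c * (b - n.+1%:R^-1) + phi n.+1%:R^-1) @[n --> \oo] --> c * (b - 0) + 0.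
    apply: cvgD; last exact: exponent_right_continuous0.
    apply: cvgMr; apply: cvgB; first exact: cvg_cst.
    exact: cvg_harmonic.
  rewrite subr0 addr0 in h1.
  rewrite -(cvg_lim (@Rhausdorff R) h1); apply: limr_le; first by apply/cvg_ex; exists (c * b).
  have : \forall n \near \oo, (n.+1%:R^-1 : R) < b.
    by apply: (cvgr_lt _ (@cvg_harmonic R)).
  apply: filterS => n nb.
  by rewrite -lerBrDr; apply: local.
exists c => // a b a0; rewrite le_eqVlt => /orP[/eqP<-|ab].
  by rewrite !subrr mulr0.
have glob t : 0 <= t -> c * t <= phi t.
  move=> t0; have [te|et] := ltP t eta; first exact: local0.
  have s0 : 0 < eta / 2 by rewrite divr_gt0.
  have st : eta / 2 < t by lra.
  have e2 : eta / 2 < eta by lra.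
  have h1 : c * (eta / 2) <= phi (eta / 2) := local0 _ (ltW s0) e2.
  have := @exponent_convex 0 (eta / 2) t (lexx _) s0 st.
  rewrite exponent_eq0 !subr0 mulr0 add0r => h2.
  have t0' : 0 < t by lra.
  rewrite -(ler_pM2l s0); apply: le_trans h2.
  have h3 : t * (c * (eta / 2)) <= t * phi (eta / 2) by rewrite ler_pM2l.
  by rewrite (_ : eta / 2 * (c * t) = t * (c * (eta / 2)))//; ring.
move: a0; rewrite le_eqVlt => /orP[/eqP a0|a0].
  by rewrite -a0 exponent_eq0 !subr0; apply: glob; lra.
have := @exponent_convex 0 a b (lexx _) a0 ab.
rewrite exponent_eq0 mulr0 add0r !subr0 => h2.
have h3 := glob a (ltW a0).
rewrite -(ler_pM2l a0).
have h4 : (b - a) * (c * a) <= (b - a) * phi a by rewrite ler_pM2l// subr_gt0.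
lra.
Qed.

End laplace_exponent_theory.

Lemma lipschitz_near_continuous (R : realType) (f : R -> R) :
  (forall a, exists2 k, 0 <= k &
     forall b, `|b - a| <= 1 -> `|f b - f a| <= k * `|b - a|) ->
  continuous f.
Proof.
move=> lip a; have [k k0 hk] := lip a.
apply/cvgrPdist_le => /= e e0.
have k1 : 0 < k + 1 by lra.
pose r := Num.min 1 (e / (k + 1)).
have r0 : 0 < r by rewrite lt_min ltr01/= divr_gt0.
exists r => //= b /= hb; rewrite distrC.
have ab : `|b - a| <= r by rewrite distrC ltW.
have b1 : `|b - a| <= 1 by apply: le_trans ab _; rewrite ge_min lexx.
have be : `|b - a| <= e / (k + 1) by apply: le_trans ab _; rewrite ge_min lexx orbT.
apply: le_trans (hk _ b1) _.
apply: (@le_trans _ _ (k * (e / (k + 1)))); first exact: ler_wpM2l.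
rewrite mulrCA -[leRHS]mulr1 ler_pM2l// ler_pdivrMr//; lra.
Qed.

Lemma max0_contraction (R : realType) (a b : R) :
  `|Num.max 0 b - Num.max 0 a| <= `|b - a|.
Proof.
rewrite /Num.max; case: ltP => ?; case: ltP => ?; rewrite ?subrr ?normr0//;
rewrite ?subr0 ?sub0r ?normrN; move: (ler_norm (b - a)) (ler_norm (a - b));
rewrite (distrC a b) => ? ?; rewrite ger0_norm; lra.
Qed.

Section exponent_inverse.
Context (R : realType) (phi : R -> R) (c : R).
Hypothesis phi0 : phi 0 = 0.
Hypothesis phi_convex : forall u v w : R, 0 <= u -> u < v -> v < w ->
  (w - u) * phi v <= (w - v) * phi u + (v - u) * phi w.
Hypothesis c_gt0 : 0 < c.
Hypothesis phi_growth : forall a b : R,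
  0 <= a -> a <= b -> c * (b - a) <= phi b - phi a.

Lemma exponent_le (a b : R) : 0 <= a -> a <= b -> phi a <= phi b.
Proof.
move=> a0 ab; have := phi_growth a0 ab.
have : 0 <= c * (b - a) by rewrite mulr_ge0 ?subr_ge0// ltW.
lra.
Qed.

Lemma exponent_ge0 (a : R) : 0 <= a -> 0 <= phi a.
Proof. by move=> a0; rewrite -phi0 exponent_le. Qed.

(** The slope of a convex function on [[a, b]] is at most its slope on
    [[a, M + 1]], an interval of length at least one. *)
Lemma exponent_lipschitz (M a b : R) : 0 <= a -> a <= b -> b <= M ->
  phi b - phi a <= phi (M + 1) * (b - a).
Proof.
move=> a0; rewrite le_eqVlt => /orP[/eqP<- _|ab bM].
  by rewrite !subrr mulr0.
have bM1 : b < M + 1 by lra.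
have h := phi_convex a0 ab bM1.
have ha := exponent_ge0 a0.
have hab := exponent_le a0 (ltW ab).
have h1 : 0 <= (b - a) * phi a by rewrite mulr_ge0 ?subr_ge0// ltW.
have h2 : 0 <= (M - a) * (phi b - phi a) by rewrite mulr_ge0 ?subr_ge0//; lra.
lra.
Qed.

(** Precomposing with [Num.max 0] turns continuity on the half line into
    continuity on the line, which composes freely. *)
Lemma exponent_continuous : continuous (phi \o Num.max 0).
Proof.
apply: lipschitz_near_continuous => a; pose M := Num.max 0 a + 1.
have M0 : 0 <= M by rewrite addr_ge0// le_max lexx.
exists (phi (M + 1)); first by apply: exponent_ge0; rewrite addr_ge0.
move=> b ba1 /=.
have pos t : 0 <= Num.max (0:R) t by rewrite le_max lexx.
have bd := max0_contraction a b.
have hM : Num.max 0 b <= M.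
  rewrite /M -lerBlDl; apply: le_trans (ler_norm _) _; exact: le_trans bd _.
have hMa : Num.max 0 a <= M by rewrite /M lerDl.
apply: (@le_trans _ _ (phi (M + 1) * `|Num.max 0 b - Num.max 0 a|)); last first.
  by rewrite ler_wpM2l// exponent_ge0//; lra.
have [ab|ba] := leP (Num.max 0 a) (Num.max 0 b).
  rewrite !ger0_norm ?subr_ge0//; first exact: exponent_lipschitz.
  exact: exponent_le.
rewrite distrC [X in _ * X]distrC !ger0_norm ?subr_ge0 ?(ltW ba)//.
  by apply: exponent_lipschitz => //; exact: ltW.
by apply: exponent_le => //; exact: ltW.
Qed.

Lemma exponent_surjective (q : R) : 0 <= q -> exists2 a, 0 <= a & phi a = q.
Proof.
move=> q0.
have qc : 0 <= q / c by rewrite divr_ge0// ltW.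
have hq : q <= phi (q / c).
  have := phi_growth (lexx 0) qc; rewrite phi0 !subr0.
  by rewrite mulrCA divff ?gt_eqF// mulr1.
have [||a] := @IVT R (phi \o Num.max 0) 0 (q / c) q qc.
- by apply: continuous_subspaceT; exact: exponent_continuous.
- rewrite /= maxxx phi0 (max_idPr qc).
  by rewrite ge_min q0/= le_max hq orbT.
- rewrite in_itv/= => /andP[a0 _]; rewrite (max_idPr a0) => <-.
  by exists a.
Qed.

Lemma exponent_inv_spec (q : R) : 0 <= q ->
  0 <= exponent_inv phi q /\ phi (exponent_inv phi q) = q.
Proof.
move=> q0.
have qi : q \in phi @` `[0, +oo[.
  have [a a0 <-] := exponent_surjective q0.
  by rewrite inE; exists a => //=; rewrite in_itv/= a0.
split; last by rewrite /exponent_inv pinvK.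
have : exponent_inv phi q \in (`[0, +oo[%classic : set R).
  rewrite inE; have [a aA <-] := set_mem qi.
  have inj : {in `[0, +oo[%classic : set R &, injective phi}.
    move=> s t /[!inE]/=; rewrite !in_itv/= !andbT => s0 t0 st.
    wlog le_st : s t s0 t0 st / s <= t.
      by move=> H; have [/H->//|/ltW/H->//] := leP s t.
    have := phi_growth s0 le_st; rewrite st subrr.
    rewrite pmulr_rle0// => ?; lra.
  by rewrite /exponent_inv pinvKV// inE.
by rewrite inE/= in_itv/= andbT.
Qed.

(** The growth bound makes the inverse Lipschitz with constant [c^-1]. *)
Lemma measurable_exponent_inv :
  measurable_fun setT (fun q : R => exponent_inv phi (Num.max 0 q)).
Proof.
have pos t : 0 <= Num.max (0:R) t by rewrite le_max lexx.
apply: continuous_measurable_fun.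
apply: lipschitz_near_continuous => a; exists c^-1; first by rewrite invr_ge0 ltW.
move=> b _.
have bd := max0_contraction a b.
rewrite [leRHS]mulrC ler_pdivlMr// mulrC /=; apply: le_trans bd.
have [b0 eb] := exponent_inv_spec (pos b).
have [a0 ea] := exponent_inv_spec (pos a).
set u := exponent_inv _ _ in b0 eb *; set v := exponent_inv _ _ in a0 ea *.
rewrite -eb -ea.
have [vu|/ltW uv] := leP v u.
  rewrite ger0_norm ?subr_ge0//; apply: le_trans (ler_norm _); exact: phi_growth.
rewrite distrC [leRHS]distrC.
rewrite ger0_norm ?subr_ge0//; apply: le_trans (ler_norm _); exact: phi_growth.
Qed.

End exponent_inverse.

(** * Paths without negative jumps *)

Section spectrally_positive_path.
Context (R : realType) (f : R -> R).
Hypothesis f_cadlag : cadlag f.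
Hypothesis f_jumps : no_negative_jumps f.
Hypothesis f0 : f 0 = 0.

(** A path falls by little between two times close to [u]: on either side of
    [u] it has a limit, and crossing [u] it can only jump upwards. *)
Lemma local_lower_modulus (u eps : R) : 0 <= u -> 0 < eps ->
  exists2 eta, 0 < eta & forall s r, 0 <= s -> s <= r ->
    u - eta < s -> r < u + eta -> f s - f r <= eps.
Proof.
move=> u0 eps0; have e2 : 0 < eps / 2 by lra.
have [fr fl] := f_cadlag.
have : \forall s \near u^'+, `|f u - f s| <= eps / 2.
  by apply: (cvgrPdist_le _ _).1 => //; exact: fr.
case=> d1 /= d10 h1.
have right s : u <= s -> s < u + d1 -> `|f u - f s| <= eps / 2.
  rewrite le_eqVlt => /orP[/eqP<- _|us sd]; first by rewrite subrr normr0 ltW.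
  by apply: h1 => //=; rewrite distrC ger0_norm; lra.
move: u0; rewrite le_eqVlt => /orP[/eqP u0|u0].
  exists d1 => // s r s0 sr _ rd.
  have : `|f u - f s| <= eps / 2 by apply: right; lra.
  have : `|f u - f r| <= eps / 2 by apply: right; lra.
  rewrite !ler_norml; lra.
have [l hl] := fl _ u0.
have lu : l <= f u by exact: f_jumps hl.
have : \forall s \near u^'-, `|l - f s| <= eps / 2 by apply: (cvgrPdist_le _ _).1.
case=> d2 /= d20 h2.
have left s : s < u -> u - d2 < s -> `|l - f s| <= eps / 2.
  by move=> su sd; apply: h2 => //=; rewrite ger0_norm; lra.
exists (Num.min d1 d2); first by rewrite lt_min d10.
move=> s r s0 sr us ru.
have m1 : Num.min d1 d2 <= d1 by rewrite ge_min lexx.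
have m2 : Num.min d1 d2 <= d2 by rewrite ge_min lexx orbT.
have [su|us'] := ltP s u; last first.
  have : `|f u - f s| <= eps / 2 by apply: right; lra.
  have : `|f u - f r| <= eps / 2 by apply: right; lra.
  rewrite !ler_norml; lra.
have := left s su ltac:(lra).
have [ru'|ur] := ltP r u.
  have := left r ru' ltac:(lra); rewrite !ler_norml; lra.
have := right r ur ltac:(lra); rewrite !ler_norml; lra.
Qed.

(** Compactness makes the local modulus uniform.  Only falls are controlled:
    positive jumps rule out a modulus for rises, but the running infimum does
    not see rises. *)
Lemma lower_modulus (T eps : R) : 0 < eps ->
  exists2 eta, 0 < eta & forall s r, 0 <= s -> s <= r -> r <= T ->
    r - s < eta -> f s - f r <= eps.
Proof.
move=> eps0.
pose Q (e u : R) := forall s r, 0 <= s -> s <= r ->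
    u - e < s -> r < u + e -> f s - f r <= eps.
have ncov : near_covering (`[0, T]%classic : set R).
  by apply/compact_near_coveringP; exact: segment_compact.
have cover : forall u, `[0, T]%classic u ->
    \forall u' \near u & e \near (0:R)^'+, Q e u'.
  move=> u; rewrite /= in_itv/= => /andP[u0 uT].
  have [eta eta0 h] := local_lower_modulus u0 eps0.
  exists ([set u' | `|u - u'| < eta / 2], [set e : R | e < eta / 2]) => /=.
    split; first by exists (eta / 2) => /=; [lra|].
    by apply: nbhs_right_lt; lra.
  move=> [u' e] /= [uu' ee] s r s0 sr us ru; apply: h => //.
    by move: uu'; rewrite ltr_norml => /andP[]; lra.
  by move: uu'; rewrite ltr_norml => /andP[]; lra.
have [eta /= eta0 h] := ncov _ _ _ (at_right_proper_filter (0:R)) cover.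
exists (eta / 2); first by lra.
move=> s r s0 sr rT rs.
have hQ : `[0, T]%classic `<=` Q (eta / 2).
  have e2 : 0 < eta / 2 by lra.
  by apply: h => //=; rewrite sub0r normrN gtr0_norm//; lra.
apply: (hQ s) => //; [|lra|lra].
by rewrite /= in_itv/= s0 (le_trans sr).
Qed.

(** Cut [[0, T]] into steps on each of which the path falls by at most one. *)
Lemma path_bounded_below (T : R) : exists m, forall s, 0 <= s -> s <= T -> m <= f s.
Proof.
have [eta eta0 h] := lower_modulus T (@ltr01 R).
have step n s : 0 <= s -> s <= T -> s <= n%:R * (eta / 2) -> - n%:R <= f s.
  elim: n s => [|n IH] s s0 sT sn.
    have -> : s = 0 by apply/le_anti; rewrite s0 -(mul0r (eta / 2)) sn.
    by rewrite f0 oppr0.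
  pose s' := Num.max 0 (s - eta / 2).
  have s'0 : 0 <= s' by rewrite le_max lexx.
  have s'1 : s - eta / 2 <= s' by rewrite le_max lexx orbT.
  have s's : s' <= s by rewrite ge_max s0; lra.
  have s'n : s' <= n%:R * (eta / 2).
    rewrite ge_max mulr_ge0//=; last by lra.
    by move: sn; rewrite -natr1; lra.
  have := IH s' s'0 (le_trans s's sT) s'n.
  have := h s' s s'0 s's sT ltac:(lra).
  by rewrite -natr1; lra.
(* The number of steps of length [eta / 2] needed to cover [[0, T]]. *)
pose N := (Num.truncn (T / (eta / 2))).+1.
exists (- N%:R) => s s0 sT; apply: step => //.
rewrite -ler_pdivrMr; last by lra.
apply: le_trans (ltW (truncnS_gt _)).
by rewrite ler_pM2r// invr_gt0; lra.
Qed.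

Lemma regulator_ubound (s t : R) : 0 <= s -> s <= t -> - f s <= regulator f t.
Proof.
move=> s0 st; rewrite /regulator lerN2; apply: ge_inf; last first.
  by exists s => //=; rewrite in_itv/= s0.
have [m hm] := path_bounded_below t.
by exists m => _ [r /=] /[!in_itv]/= /andP[r0 rt] <-; exact: hm.
Qed.

Lemma regulator_least (t k : R) : 0 <= t ->
  (forall s, 0 <= s -> s <= t -> - f s <= k) -> regulator f t <= k.
Proof.
move=> t0 h; rewrite /regulator lerNl; apply: lb_le_inf.
  by exists (f 0), 0 => //=; rewrite in_itv/= lexx.
by move=> _ [r /=] /[!in_itv]/= /andP[r0 rt] <-; rewrite lerNl; exact: h.
Qed.

Lemma regulator_lt0 (t : R) : t < 0 -> regulator f t = 0.
Proof.
move=> t0; rewrite /regulator set_itv_ge ?image_set0 ?inf0 ?oppr0//.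
by rewrite bnd_simp -ltNge.
Qed.

Lemma regulator_ge0 (t : R) : 0 <= t -> 0 <= regulator f t.
Proof. by move=> t0; have := regulator_ubound (lexx 0) t0; rewrite f0 oppr0. Qed.

Lemma regulator_le (s t : R) : 0 <= s -> s <= t -> regulator f s <= regulator f t.
Proof.
move=> s0 st; apply: regulator_least => // r r0 rs.
by apply: regulator_ubound => //; exact: le_trans st.
Qed.

Lemma regulator_nondecreasing : nondecreasing_fun (regulator f).
Proof.
move=> s t st; have [s0|s0] := leP 0 s; first exact: regulator_le.
rewrite (regulator_lt0 s0); have [t0|t0] := leP 0 t; first exact: regulator_ge0.
by rewrite regulator_lt0.
Qed.

Lemma measurable_regulator : measurable_fun setT (regulator f).
Proof. exact: nondecreasing_measurable regulator_nondecreasing. Qed.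

(** In particular the regulator is continuous. *)
Lemma regulator_modulus (T eps eta : R) :
  (forall s r, 0 <= s -> s <= r -> r <= T -> r - s < eta -> f s - f r <= eps) ->
  0 < eps -> forall s r, 0 <= s -> s <= r -> r <= T -> r - s < eta ->
    regulator f r <= regulator f s + eps.
Proof.
move=> h e0 s r s0 sr rT rs; apply: regulator_least; first exact: le_trans sr.
move=> v v0 vr; have [vs|sv] := leP v s.
  by have := regulator_ubound v0 vs; lra.
have := h s v s0 (ltW sv) (le_trans vr rT) ltac:(lra).
have := regulator_ubound s0 (lexx s); lra.
Qed.

End spectrally_positive_path.

(** * Sampling a path on a grid *)

Section riemann_sums.
Context (R : realType).
Local Notation leb := (@lebesgue_measure R).

Definition primitive (u : R -> R) (s : R) : R := \int[leb]_(r in `[0, s]) u r.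

Context (u : R -> R) (B : R).
Hypothesis mu : measurable_fun setT u.
Hypothesis u_bounded : forall s, `|u s| <= B.

Lemma bounded_integrable (i : interval R) : (leb [set` i] < +oo)%E ->
  leb.-integrable [set` i] (EFin \o u).
Proof.
move=> ioo; apply: measurable_bounded_integrable => //; first exact: measurable_funTS.
exists B; split; first exact: num_real.
by move=> M BM x _; exact: le_trans (ltW BM).
Qed.

Lemma bounded_itv_integrable (b0 b1 : bool) (a b : R) :
  leb.-integrable [set` Interval (BSide b0 a) (BSide b1 b)] (EFin \o u).
Proof.
by apply: bounded_integrable; rewrite lebesgue_measure_itv/=; case: ifP => _; rewrite ?ltry.
Qed.

Lemma primitive_increment (a b k eps : R) : 0 <= a -> a <= b ->
  (forall s, a <= s -> s <= b -> `|u s - k| <= eps) ->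
  `|primitive u b - primitive u a - k * (b - a)| <= eps * (b - a).
Proof.
move=> a0 ab hk; rewrite /primitive Rintegral_itvB; last 3 first.
- exact: bounded_itv_integrable.
- by rewrite bnd_simp.
- by rewrite bnd_simp.
have cst_int r : \int[leb]_(_ in `]a, b]) r = r * (b - a).
  rewrite Rintegral_cst//= lebesgue_measure_itv/= lte_fin.
  case: ltP => [_|ba]; first by rewrite -EFinD.
  by rewrite (_ : b = a) ?subrr ?mulr0//; apply/le_anti; rewrite ab ba.
have itv_cst r : leb.-integrable `]a, b] (EFin \o (fun=> r)).
  apply: measurable_bounded_integrable => //=.
    by rewrite lebesgue_measure_itv/=; case: ifP => _; rewrite ?ltry.
  by exists `|r|; split; [exact: num_real|move=> M rM x _; exact: ltW].
have iu := bounded_itv_integrable false false a b.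
rewrite ler_norml; apply/andP; split.
- rewrite lerBrDr -mulNr -mulrDl -cst_int; apply: le_Rintegral => // s /=.
  rewrite in_itv/= => /andP[sa sb].
  by have := hk s (ltW sa) sb; rewrite ler_norml; lra.
- rewrite lerBlDr -mulrDl -cst_int; apply: le_Rintegral => // s /=.
  rewrite in_itv/= => /andP[sa sb].
  by have := hk s (ltW sa) sb; rewrite ler_norml; lra.
Qed.

Lemma primitive0 : primitive u 0 = 0.
Proof. by rewrite /primitive set_itv1 Rintegral_set1. Qed.

Lemma primitive_lipschitz (a b : R) : 0 <= a -> a <= b ->
  `|primitive u b - primitive u a| <= B * (b - a).
Proof.
move=> a0 ab; have := @primitive_increment a b 0 B a0 ab.
rewrite mul0r subr0; apply => s _ _; by rewrite subr0.
Qed.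

(** Used twice, with the nodes [p] either the times of a grid or the successive
    values of a running maximum; [k] are the values attached to the left
    nodes. *)
Lemma riemann_sum_error (p k : nat -> R) (n : nat) (eps : R) :
  p 0%N = 0 -> (forall j, (j < n)%N -> p j <= p j.+1) ->
  (forall j, (j < n)%N -> forall s, p j <= s -> s <= p j.+1 -> `|u s - k j| <= eps) ->
  `|\sum_(j < n) k j * (p j.+1 - p j) - primitive u (p n)| <= eps * p n /\ 0 <= p n.
Proof.
move=> p0; elim: n => [|n IH] pm pk.
  by rewrite big_ord0 p0 primitive0 subrr normr0 mulr0.
have [IH1 IH2] := IH (fun j jn => pm j (ltnW jn)) (fun j jn => pk j (ltnW jn)).
have le_p := pm n (ltnSn n).
have := primitive_increment IH2 le_p (pk n (ltnSn n)).
rewrite big_ord_recr/=; split; last exact: le_trans le_p.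
set S := \sum_(_ < n) _ in IH1 *.
move: IH1 H; rewrite !ler_norml => /andP[? ?] /andP[? ?]; apply/andP; split; lra.
Qed.

End riemann_sums.

Lemma integral_half_line_primitive (R : realType) (u : R -> R) (B M : R) :
  measurable_fun setT u -> (forall y, `|u y| <= B) -> 
  (forall y, M < y -> u y = 0) ->
  (\int[lebesgue_measure]_(y in `[0%R, +oo[) (u y)%:E = (primitive u M)%:E)%E.
Proof.
move=> mu ub u0; rewrite /primitive /Rintegral fineK; last first.
  apply: integrable_fin_num => //.
  exact: (bounded_itv_integrable mu ub true false).
rewrite [LHS]integral_mkcond [RHS]integral_mkcond.
apply: eq_integral => y _; rewrite /= !patchE !mem_setE !in_itv/= andbT.
case: (leP 0 y) => //= _; case: (leP y M) => //= My; by rewrite u0.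
Qed.

Section discrete_skeleton.
Context (R : realType).

Fixpoint running_max (x : nat -> R) (n : nat) : R :=
  if n is m.+1 then Num.max (running_max x m) (- x m.+1) else 0.

Lemma running_max_le (x : nat -> R) (m n : nat) : (m <= n)%N ->
  running_max x m <= running_max x n.
Proof.
elim: n => [|n IH]; first by rewrite leqn0 => /eqP->.
rewrite leq_eqVlt => /orP[/eqP->//|]; rewrite ltnS => /IH h.
by apply: le_trans h _; rewrite /= le_max lexx.
Qed.

Lemma running_max_ubound (x : nat -> R) (n : nat) : x 0%N = 0 ->
  - x n <= running_max x n.
Proof. by case: n => [->|n _] /=; rewrite ?oppr0// le_max lexx orbT. Qed.

Lemma running_max_least (x : nat -> R) (k : R) (n : nat) : 0 <= k ->
  (forall j, (j <= n)%N -> - x j <= k) -> running_max x n <= k.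
Proof.
move=> k0; elim: n => //= n IH h; rewrite ge_max h// andbT; apply: IH => j jn.
exact/h/leqW.
Qed.

Lemma running_max_step (x : nat -> R) (n : nat) : x 0%N = 0 ->
  running_max x n.+1 - running_max x n <= Num.max 0 (x n - x n.+1).
Proof.
move=> x0; have := running_max_ubound n x0 => /=; rewrite /Num.max.
by do 2 case: ltP => ?; move=> h; lra.
Qed.

(** Abel summation.  Put [l = running_max x].  Whenever [l] increases,
    [x + l] vanishes at the new index, so replacing [theta (l j)] by
    [theta (l j.+1)] in front of [x j.+1 + l j.+1] changes nothing, and the sum
    telescopes without error term. *)
Lemma skeleton_summation_by_parts (theta : R -> R) (x : nat -> R) (n : nat) :
  x 0%N = 0 ->
  \sum_(j < n) theta (running_max x j) * (x j.+1 - x j) =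
  theta (running_max x n) * (x n + running_max x n) -
  \sum_(j < n) theta (running_max x j) * (running_max x j.+1 - running_max x j).
Proof.
move=> x0; elim: n => [|n IH]; first by rewrite !big_ord0 /= x0 addr0 mulr0 subr0.
rewrite !big_ord_recr IH /=.
set S := \sum_(_ < n) _; set l := running_max x n.
rewrite /Num.max; case: ltP => _; ring.
Qed.

End discrete_skeleton.

Arguments running_max : simpl never.

Section skeleton_convergence.
Context (R : realType).

Definition uniformly_continuous (u : R -> R) : Prop :=
  forall eps, 0 < eps -> exists2 eta, 0 < eta &
    forall a b, `|a - b| < eta -> `|u a - u b| <= eps.

Lemma uniformly_continuous_continuous (u : R -> R) :
  uniformly_continuous u -> continuous u.
Proof.
move=> uc a; apply/cvgrPdist_le => /= e e0.
have [eta eta0 h] := uc e e0.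
by exists eta => //= b /= ab; exact: h.
Qed.

Context (f : R -> R).
Hypothesis f_cadlag : cadlag f.
Hypothesis f_jumps : no_negative_jumps f.
Hypothesis f0 : f 0 = 0.
Local Notation L := (regulator f).

Definition grid (t : R) (N j : nat) : R := f (j%:R * (t / N.+1%:R)).

Lemma grid0 t N : grid t N 0 = 0.
Proof. by rewrite /grid mul0r f0. Qed.

Lemma grid_end t N : grid t N N.+1 = f t.
Proof. by rewrite /grid mulrCA divff// mulr1. Qed.

(** The running maximum over the grid misses little of the regulator: the path
    at the grid point just before [s] exceeds [f s] by at most [eps]. *)
Lemma grid_running_max (t eps eta : R) (N j : nat) : 0 < t -> 0 < eps ->
  (forall s r, 0 <= s -> s <= r -> r <= t -> r - s < eta -> f s - f r <= eps) ->
  t / N.+1%:R < eta -> (j <= N.+1)%N ->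
  L (j%:R * (t / N.+1%:R)) - eps <= running_max (grid t N) j /\
  running_max (grid t N) j <= L (j%:R * (t / N.+1%:R)).
Proof.
move=> t0 e0 hmod hN jN; set del := t / _ in hN *.
have del0 : 0 < del by rewrite divr_gt0.
have tE : t = N.+1%:R * del by rewrite /del mulrCA divff// mulr1.
have pos i : 0 <= i%:R * del by rewrite mulr_ge0// ltW.
have mono i k : (i <= k)%N -> i%:R * del <= k%:R * del.
  by move=> ik; rewrite ler_pM2r// ler_nat.
split; last first.
  apply: running_max_least; first exact: regulator_ge0.
  by move=> i ij; apply: regulator_ubound => //; exact: mono.
rewrite lerBlDr; apply: regulator_least => // s s0 sj.
pose i := Num.truncn (s / del).
have sd : 0 <= s / del by rewrite divr_ge0// ltW.
have /andP[i1 i2] := truncn_itv sd.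
rewrite -/i ler_pdivlMr// in i1; rewrite -/i ltr_pdivrMr// -natr1 in i2.
have ij : (i <= j)%N.
  by rewrite -(ler_nat R) -(ler_pM2r del0) (le_trans i1).
have st : s <= t by rewrite (le_trans sj)// tE; exact: mono.
have h1 := hmod _ s (pos i) i1 st ltac:(lra).
have h2 : - grid t N i <= running_max (grid t N) i.
  by apply: running_max_ubound; exact: grid0.
have h3 := running_max_le (grid t N) ij.
rewrite /grid -/del in h2 h3 *; lra.
Qed.

Lemma grid_mesh (t eta : R) : 0 < eta -> \forall N \near \oo, t / N.+1%:R < eta.
Proof.
move=> eta0; have h : (t * N.+1%:R^-1) @[N --> \oo] --> t * 0.
  by apply: cvgMr; exact: cvg_harmonic.
by rewrite mulr0 in h; apply: (cvgr_lt _ h).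
Qed.

Lemma running_max_cvg (t : R) : 0 < t ->
  running_max (grid t N) N.+1 @[N --> \oo] --> L t.
Proof.
move=> t0; apply/cvgrPdist_le => /= e e0.
have [eta eta0 hmod] := lower_modulus f_cadlag f_jumps t e0.
have := grid_mesh t eta0; apply: filterS => N hN.
have [] := grid_running_max t0 e0 hmod hN (leqnn _).
rewrite (_ : N.+1%:R * (t / N.+1%:R) = t); last by rewrite mulrCA divff// mulr1.
by move=> h1 h2; rewrite ger0_norm ?subr_ge0//; lra.
Qed.

Section limits.
Context (u : R -> R) (B : R).
Hypothesis u_uc : uniformly_continuous u.
Hypothesis u_bounded : forall s, `|u s| <= B.

Lemma measurable_uc : measurable_fun setT u.
Proof. by apply: continuous_measurable_fun; exact: uniformly_continuous_continuous. Qed.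

(** A Riemann sum of [u] whose nodes are the values of the running maximum;
    its mesh is small because the running maximum increases by at most the fall
    of the path over one grid step. *)
Lemma local_time_sum_cvg (t : R) : 0 < t ->
  \sum_(j < N.+1) u (running_max (grid t N) j) *
     (running_max (grid t N) j.+1 - running_max (grid t N) j)
    @[N --> \oo] --> primitive u (L t).
Proof.
move=> t0; apply/cvgrPdist_le => /= e e0.
have Lt0 : 0 <= L t by apply: regulator_ge0 => //; exact: ltW.
have B0 : 0 <= B := le_trans (normr_ge0 (u 0)) (u_bounded 0).
(* Half of [e] pays for the Riemann sum, whose nodes span at most [L t], and
   half for its stopping at the running maximum instead of [L t]. *)
pose e1 := e / (2 * (L t + 1)).
have e10 : 0 < e1 by rewrite divr_gt0// mulr_gt0//; lra.
have [zeta zeta0 hu] := u_uc e10.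
pose e2 := Num.min (zeta / 2) (e / (2 * (B + 1))).
have e20 : 0 < e2.
  by rewrite lt_min !divr_gt0// ?mulr_gt0//; lra.
have [eta eta0 hmod] := lower_modulus f_cadlag f_jumps t e20.
have := grid_mesh t eta0; apply: filterS => N hN.
have del0 : 0 < t / N.+1%:R by rewrite divr_gt0.
have := @riemann_sum_error R u B measurable_uc u_bounded
  (running_max (grid t N)) (u \o running_max (grid t N)) N.+1 e1 erefl.
case.
- by move=> j _; exact: running_max_le.
- move=> j jN s js sj; apply/hu.
  rewrite ger0_norm ?subr_ge0//.
  have := running_max_step j (grid0 t N).
  have h : grid t N j - grid t N j.+1 <= e2.
    apply: hmod.
    + by rewrite mulr_ge0// ltW.
    + by rewrite ler_pM2r// ler_nat.
    + rewrite [leRHS](_ : t = N.+1%:R * (t / N.+1%:R)); last by rewrite mulrCA divff// mulr1.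
      by rewrite ler_pM2r// ler_nat.
    + by rewrite -mulrBl -natrB// subSnn mul1r.
  have h' : e2 <= zeta / 2 by rewrite ge_min lexx.
  have : Num.max 0 (grid t N j - grid t N j.+1) <= zeta / 2.
    by rewrite ge_max; apply/andP; split; lra.
  lra.
move=> h1 h2.
have [] := grid_running_max t0 e20 hmod hN (leqnn _).
rewrite (_ : N.+1%:R * (t / N.+1%:R) = t); last by rewrite mulrCA divff// mulr1.
move=> h3 h4.
have h5 := primitive_lipschitz measurable_uc u_bounded h2 h4.
have h6 : B * (L t - running_max (grid t N) N.+1) <= e / 2.
  apply: (@le_trans _ _ (B * (e / (2 * (B + 1))))).
    apply: ler_wpM2l => //.
    have : e2 <= e / (2 * (B + 1)) by rewrite ge_min lexx orbT.
    lra.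
  rewrite mulrA ler_pdivrMr; last by lra.
  have : 0 <= e * B by rewrite mulr_ge0// ltW.
  lra.
have h7 : e1 * running_max (grid t N) N.+1 <= e / 2.
  apply: (@le_trans _ _ (e1 * (L t + 1))); first by rewrite ler_pM2l//; lra.
  rewrite /e1 le_eqVlt; apply/orP; left; apply/eqP; field; lra.
move: h1 h5; rewrite /= !ler_norml => /andP[? ?] /andP[? ?]; apply/andP; split; lra.
Qed.

Lemma clock_sum_cvg (t : R) : 0 < t ->
  \sum_(j < N.+1) u (running_max (grid t N) j) * (t / N.+1%:R)
    @[N --> \oo] --> primitive (u \o L) t.
Proof.
move=> t0; apply/cvgrPdist_le => /= e e0.
pose e1 := e / t.
have e10 : 0 < e1 by rewrite divr_gt0.
have [zeta zeta0 hu] := u_uc e10.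
have z2 : 0 < zeta / 4 by rewrite divr_gt0.
have [eta eta0 hmod] := lower_modulus f_cadlag f_jumps t z2.
have := grid_mesh t eta0; apply: filterS => N hN; set del := t / N.+1%:R in hN *.
have del0 : 0 < del by rewrite divr_gt0.
have tE : N.+1%:R * del = t by rewrite /del mulrCA divff// mulr1.
have muL : measurable_fun setT (u \o L).
  apply: measurableT_comp; first exact: measurable_uc.
    exact: (measurable_regulator f_cadlag f_jumps f0).
have := @riemann_sum_error R (u \o L) B muL (fun s => u_bounded (L s))
  (fun j => j%:R * del) (u \o running_max (grid t N)) N.+1 e1 (mul0r _).
case.
- by move=> j _; rewrite ler_pM2r// ler_nat.
- move=> j jN s js sj; apply/hu.
  have [h1 h2] := grid_running_max t0 z2 hmod hN (ltnW jN).
  rewrite -/del in h1 h2.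
  have j0 : 0 <= j%:R * del by rewrite mulr_ge0// ltW.
  have st : s <= t by rewrite (le_trans sj)// -tE ler_pM2r// ler_nat.
  have sdel : s - j%:R * del < eta by move: sj; rewrite -natr1; lra.
  have h3 := regulator_le f_cadlag f_jumps f0 j0 js.
  have h4 := regulator_modulus f_cadlag f_jumps f0 hmod z2 j0 js st sdel.
  rewrite ger0_norm; lra.
rewrite tE divfK ?gt_eqF// => h _; rewrite distrC; apply: le_trans h.
rewrite le_eqVlt; apply/orP; left; apply/eqP; congr `|_ - _|.
by apply: eq_bigr => j _; rewrite -mulrBl -natrB// subSnn mul1r.
Qed.

End limits.

(** Pathwise passage to the limit in the exponent: after summation by parts its
    two sums are Riemann sums, in space and in time. *)
Lemma skeleton_exponent_cvg (theta kappa : R -> R) (B t : R) : 0 < t ->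
  uniformly_continuous theta -> uniformly_continuous kappa ->
  (forall s, `|theta s| <= B) -> (forall s, `|kappa s| <= B) ->
  - \sum_(j < N.+1) (theta (running_max (grid t N) j) *
       (grid t N j.+1 - grid t N j) +
       kappa (running_max (grid t N) j) * (t / N.+1%:R))
    @[N --> \oo] -->
  - theta (L t) * reflected f t + primitive theta (L t) - primitive (kappa \o L) t.
Proof.
move=> t0 ut uk bt bk.
rewrite [X in X @ _ --> _](_ : _ = fun N =>
  - theta (running_max (grid t N) N.+1) * (f t + running_max (grid t N) N.+1) +
  \sum_(j < N.+1) theta (running_max (grid t N) j) *
     (running_max (grid t N) j.+1 - running_max (grid t N) j)
  - \sum_(j < N.+1) kappa (running_max (grid t N) j) * (t / N.+1%:R)); last first.
  apply/funext => N; rewrite big_split/= skeleton_summation_by_parts ?grid0//.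
  by rewrite grid_end; ring.
apply: cvgB; last exact: (clock_sum_cvg uk bk).
apply: cvgD; last exact: (local_time_sum_cvg ut bt).
have h := running_max_cvg t0.
apply: cvgM; last by apply: cvgD => //; exact: cvg_cst.
apply: cvgN; apply: continuous_cvg => //.
exact: uniformly_continuous_continuous.
Qed.

End skeleton_convergence.

(** * The exponential martingale of the sampled process *)

Section freezing.
Context (d d1 d2 : measure_display) (Omega : measurableType d)
  (S : measurableType d1) (T : measurableType d2) (R : realType).
Context (P : probability Omega R) (U : {mfun Omega >-> S}) (Y : {mfun Omega >-> T}).
Hypothesis indep : forall A B, measurable A -> measurable B ->
  P (U @^-1` A `&` Y @^-1` B) = (P (U @^-1` A) * P (Y @^-1` B))%E.

(** Fubini for the law of [(U, Y)], which independence makes a product measure: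
    an expectation may be computed with [U] frozen. *)
Lemma integral_freezing (F : S * T -> \bar R) : measurable_fun setT F ->
  (forall z, 0 <= F z)%E ->
  (\int[P]_w F (U w, Y w) = \int[P]_w \int[P]_w' F (U w, Y w'))%E.
Proof.
move=> mF F0.
pose UY w := (U w, Y w).
have mUY : measurable_fun setT UY.
  by apply/measurable_fun_pairP; split; exact: measurable_funP.
pose pUY : {mfun Omega >-> (S * T)%type} := HB.pack UY (isMeasurableFun.Build _ _ _ _ _ mUY).
have h : forall C, measurable C ->
    (distribution P U \x distribution P Y)%E C = distribution P pUY C.
  apply: product_measure_unique => A B mA mB.
  by rewrite /distribution /pushforward -indep.
rewrite -(ge0_integral_distribution pUY mF F0).
transitivity (\int[(distribution P U \x distribution P Y)%E]_z F z)%E.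
  by apply: eq_measure_integral => C mC _; exact/esym/h.
rewrite fubini_tonelli1// ge0_integral_distribution//; last 2 first.
- exact: measurable_fun_fubini_tonelli_F.
- by move=> y; apply: integral_ge0.
apply: eq_integral => w _ /=; rewrite /fubini_F ge0_integral_distribution//.
exact: measurableT_comp.
Qed.
End freezing.

Section predictable_exponential.
Context (d : measure_display) (Omega : measurableType d) (R : realType)
  (P : probability Omega R) (X : R -> {RV P >-> R}) (phi : R -> R).
Hypothesis hX : spectrally_positive_levy X.
Hypothesis hphi : laplace_exponent X phi.
Context (del : R).
Hypothesis del_gt0 : 0 < del.

Definition increment (j : nat) (w : Omega) : R :=
  X (j.+1%:R * del) w - X (j%:R * del) w.

Lemma measurable_increment j : measurable_fun setT (increment j).
Proof. by apply: measurable_funB; exact: measurable_funP. Qed.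

(** The cylinder sets of the first [n] increments: a pi-system generating the
    sigma-algebra of the past.  Independence of increments is a product formula
    on such sets. *)
Definition past (n : nat) : set (set Omega) :=
  [set A | exists2 B : nat -> set R, forall i, measurable (B i) &
     A = \bigcap_(i in `I_n) (increment i @^-1` B i)].

Lemma past_setI n : setI_closed (past n).
Proof.
move=> _ _ [B mB ->] [C mC ->]; exists (fun i => B i `&` C i).
  by move=> i; exact: measurableI.
by rewrite -bigcapI.
Qed.

Lemma past_setT n : past n setT.
Proof.
exists (fun=> setT) => //; apply/esym; rewrite -subTset => w _ i _ //.
Qed.

Lemma measurable_past n : past n `<=` measurable.
Proof.
move=> _ [B mB ->]; apply: bigcap_measurableType => i _.
by rewrite -[X in measurable X]setTI; exact: measurable_increment.
Qed.

Lemma past_prod n (B : nat -> set R) : (forall i, measurable (B i)) ->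
  P (\bigcap_(i in `I_n) (increment i @^-1` B i)) =
  (\prod_(i < n) P (increment i @^-1` B i))%E.
Proof.
move=> mB.
have h := levy_independent_increments hX.
have := h n (fun i => i%:R * del) _ _ (fun i => B i).
rewrite /mutually_independent mul0r lexx => /(_ isT).
move=> /(_ _ (fun i => mB i)) <-.
  congr (P _); apply/seteqP; split=> w hw i => [_|iltn]; first exact/hw/ltn_ord.
  exact: (hw (Ordinal iltn)).
by move=> i _; rewrite ltr_pM2r// ltr_nat.
Qed.

(** Two finite measures that agree on a pi-system agree on the sigma-algebra it
    generates. *)
Lemma past_independent n (A : set Omega) (B : set R) :
  <<s past n >> A -> measurable B ->
  P (A `&` increment n @^-1` B) = (P A * P (increment n @^-1` B))%E.
Proof.
move=> sA mB.
have mYB : measurable (increment n @^-1` B).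
  by rewrite -[X in measurable X]setTI; exact: measurable_increment.
have fB : P (increment n @^-1` B) \is a fin_num by exact: fin_num_measure.
have pB : 0 <= fine (P (increment n @^-1` B)) by exact: fine_ge0.
have <- : mscale (NngNum pB) P A = (P A * P (increment n @^-1` B))%E.
  by rewrite /mscale/= fineK// muleC.
apply: (@g_sigma_algebra_measure_unique d R Omega (past n) (@measurable_past n)
  (fun=> setT) (fun=> past_setT n) _ (mrestr P mYB) (mscale (NngNum pB) P) (@past_setI n)) => //.
- by rewrite bigcup_const//; exists 0%N.
- move=> _ [C mC ->]; set A' := \bigcap_(_ in _) _.
  rewrite -[LHS]/(P (A' `&` increment n @^-1` B)).
  rewrite -[RHS]/((fine (P (increment n @^-1` B)))%:E * P A')%E fineK// [in RHS]/A' past_prod//.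
  (* Append [B] as the condition on the increment of index [n]. *)
  pose C' i := if (i < n)%N then C i else B.
  have mC' i : measurable (C' i) by rewrite /C'; case: ifP.
  have := past_prod n.+1 mC'.
  have C'n : C' n = B by rewrite /C' ltnn.
  rewrite big_ord_recr/= C'n muleC.
  rewrite (eq_bigr (fun i : 'I_n => P (increment i @^-1` C i))); last first.
    by move=> i _; rewrite /C' ltn_ord.
  move=> <-; congr (P _); apply/seteqP; split=> w.
    move=> [hC hB] i /=; rewrite ltnS leq_eqVlt => /orP[/eqP->|iltn].
      by rewrite /C' ltnn.
    by rewrite /C' iltn; exact: hC.
  move=> h; split=> [i iltn|].
    by have := h i (ltnW iltn); rewrite /C' /= iltn.
  by have := h n (ltnSn n); rewrite /C' /= ltnn.
- move=> k; rewrite -[ltLHS]/(P (setT `&` increment n @^-1` B)) setTI.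
  exact: le_lt_trans (probability_le1 _ _) (ltry _).
Qed.

Local Notation S n := (g_sigma_algebraType (past n)).

Lemma measurable_increment_past n j : (j < n)%N ->
  measurable_fun setT (increment j : S n -> R).
Proof.
move=> jn _ B mB; rewrite setTI; apply: sub_sigma_algebra.
exists (fun i => if i == j then B else setT); first by move=> i; case: ifP.
apply/seteqP; split=> [w hw i _ /=|w /(_ j jn)/=]; last by rewrite eqxx.
by case: eqP => // ->.
Qed.

Lemma measurable_skeleton_past n j : (j <= n)%N ->
  measurable_fun setT (X (j%:R * del) : S n -> R).
Proof.
elim: j => [_|j IH jn].
  rewrite [X in measurable_fun _ X](_ : _ = cst 0); first exact: measurable_cst.
  by apply/funext => w; rewrite mul0r (levy_start hX).
rewrite [X in measurable_fun _ X](_ : _ = X (j%:R * del) \+ increment j); last first.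
  by apply/funext => w; rewrite /increment/= addrC subrK.
by apply: measurable_funD; [exact: IH (ltnW jn)|exact: measurable_increment_past].
Qed.

Definition skeleton (w : Omega) (j : nat) : R := X (j%:R * del) w.

Lemma measurable_running_max_past n j : (j <= n)%N ->
  measurable_fun setT (fun w : S n => running_max (skeleton w) j).
Proof.
elim: j => [_|j IH jn]; first exact: measurable_cst.
apply: measurable_maxr; first exact: IH (ltnW jn).
by apply: measurableT_comp => //; exact: measurable_skeleton_past.
Qed.

Lemma increment_laplace j (a : R) : 0 <= a ->
  (\int[P]_w (expR (- a * increment j w))%:E = (expR (phi a * del))%:E)%E.
Proof.
move=> a0.
have := hphi a0 (ltW del_gt0); rewrite unlock => <-.
have stat := levy_stationary_increments hX (s := j%:R * del) (t := del).
have mf : measurable_fun setT (fun y : R => (expR (- a * y))%:E).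
  by apply/measurable_EFinP; apply: measurableT_comp => //; exact: measurable_funM.
have f0 y : (0 <= (expR (- a * y))%:E)%E by rewrite lee_fin expR_ge0.
have mX : measurable_fun setT (X del \- X 0) by exact: measurable_funB.
pose V : {mfun Omega >-> R} :=
  HB.pack (increment j) (isMeasurableFun.Build _ _ _ _ _ (measurable_increment j)).
pose V0 : {mfun Omega >-> R} := HB.pack (X del \- X 0) (isMeasurableFun.Build _ _ _ _ _ mX).
rewrite -(ge0_integral_distribution V mf f0).
transitivity (\int[distribution P V0]_y (expR (- a * y))%:E)%E.
  apply: eq_measure_integral => A mA _.
  transitivity (pushforward P (X (j%:R * del + del) \- X (j%:R * del)) A).
    congr (P (_ @^-1` A)); apply/funext => w.
    by rewrite /V /increment/= -natr1 mulrDl mul1r.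
  by apply: stat => //; rewrite ?mulr_ge0// ltW.
rewrite (ge0_integral_distribution V0 mf f0).
by apply: eq_integral => w _; rewrite /= (levy_start hX) subr0.
Qed.

(** The discrete counterpart of [int theta (L) dX + int phi (theta (L)) ds]; the
    weight of each increment is determined by the increments before it. *)
Definition skeleton_exponent (theta : R -> R) (n : nat) (w : Omega) : R :=
  \sum_(j < n) (theta (running_max (skeleton w) j) * increment j w +
                phi (theta (running_max (skeleton w) j)) * del).

Lemma measurable_skeleton_exponent (theta : R -> R) (n : nat) :
  measurable_fun setT theta -> measurable_fun setT (phi \o theta) ->
  measurable_fun setT (skeleton_exponent theta n).
Proof.
move=> mth mph.
have mrm j : measurable_fun setT (fun w => running_max (skeleton w) j).
  elim: j => [|j IH]; first exact: measurable_cst.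
  by apply: measurable_maxr => //; apply: measurableT_comp.
apply: measurable_sum => j; apply: measurable_funD; apply: measurable_funM => //.
- by apply: measurableT_comp => //; exact: mrm.
- exact: measurable_increment.
- by apply: (measurableT_comp mph); exact: mrm.
Qed.

(** Freezing the past, the last factor is
    [exp (- a Y - phi a * del)] for a constant [a] and a fresh increment [Y],
    which has mean one. *)
Lemma exponential_martingale (theta : R -> R) (n : nat) :
  measurable_fun setT theta -> measurable_fun setT (phi \o theta) ->
  (forall y, 0 <= theta y) ->
  (\int[P]_w (expR (- skeleton_exponent theta n w))%:E = 1)%E.
Proof.
move=> mth mph th0; elim: n => [|n IH].
  under eq_integral do rewrite /skeleton_exponent big_ord0 oppr0 expR0.
  by rewrite integral_cst//= probability_setT mule1.
(* The weight of the increment of index [n], measurable in the past. *)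
pose th (w : S n) := theta (running_max (skeleton w) n).
have mrm j : (j <= n)%N -> measurable_fun setT (fun w : S n => running_max (skeleton w) j).
  exact: measurable_running_max_past.
have mZ : measurable_fun setT (fun w : S n => expR (- skeleton_exponent theta n w)).
  apply: measurableT_comp => //; apply: measurableT_comp => //.
  apply: measurable_sum => j; apply: measurable_funD.
    apply: measurable_funM; last exact: measurable_increment_past.
    by apply: measurableT_comp => //; exact: mrm (ltnW (ltn_ord j)).
  apply: measurable_funM => //.
  by apply: (measurableT_comp mph); exact: mrm (ltnW (ltn_ord j)).
pose F (z : S n * R) := (expR (- skeleton_exponent theta n z.1) *
   expR (- th z.1 * z.2 - phi (th z.1) * del))%:E.
have mF : measurable_fun setT F.
  apply/measurable_EFinP; apply: measurable_funM.
    by apply: (measurableT_comp mZ); exact: measurable_fst.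
  apply: measurableT_comp => //; apply: measurable_funB.
    apply: measurable_funM; last exact: measurable_snd.
    apply: measurableT_comp => //; apply: (measurableT_comp mth).
    by apply: (measurableT_comp (mrm n (leqnn n))); exact: measurable_fst.
  apply: measurable_funM => //.
  apply: (measurableT_comp mph).
  by apply: (measurableT_comp (mrm n (leqnn n))); exact: measurable_fst.
have mid : measurable_fun setT (id : Omega -> S n).
  move=> _ A mA; rewrite setTI preimage_id.
  exact: (smallest_sub (@sigma_algebra_measurable _ Omega) (@measurable_past n)).
pose U : {mfun Omega >-> S n} :=
  HB.pack (id : Omega -> S n) (isMeasurableFun.Build _ _ _ _ _ mid).
pose Y : {mfun Omega >-> R} :=
  HB.pack (increment n) (isMeasurableFun.Build _ _ _ _ _ (measurable_increment n)).
have ind A B : measurable A -> measurable B ->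
  P (U @^-1` A `&` Y @^-1` B) = (P (U @^-1` A) * P (Y @^-1` B))%E.
  by move=> mA mB; exact: past_independent.
have F0 z : (0 <= F z)%E by rewrite lee_fin mulr_ge0 ?expR_ge0.
transitivity (\int[P]_w F (U w, Y w))%E.
  apply: eq_integral => w _; rewrite /F /= -expRD; congr (expR _)%:E.
  by rewrite /skeleton_exponent big_ord_recr /= -/(th w); ring.
rewrite (integral_freezing ind mF F0) -[RHS]IH.
apply: eq_integral => w _; rewrite /F /=.
under eq_integral do rewrite addrC expRD mulrA EFinM.
rewrite ge0_integralZl_EFin//=; last first.
  apply/measurable_EFinP; apply: measurableT_comp => //.
  by apply: measurable_funM => //; exact: measurable_increment.
rewrite increment_laplace; last exact: th0.
rewrite -EFinM; congr (_)%:E.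
by rewrite -mulrA -expRD addNr expR0 mulr1.
Qed.

End predictable_exponential.

(** * The exponential martingale in continuous time *)

Section integral_limits.
Context (d : measure_display) (Omega : measurableType d) (R : realType)
  (P : probability Omega R).

Lemma bounded_cvg_integral (g_ : nat -> Omega -> R) (g : Omega -> R) (M : R) :
  (forall n, measurable_fun setT (g_ n)) -> measurable_fun setT g ->
  (forall n w, `|g_ n w| <= M) ->
  {ae P, forall w, g_ n w @[n --> \oo] --> g w} ->
  (\int[P]_w (g_ n w)%:E @[n --> \oo] --> \int[P]_w (g w)%:E)%E.
Proof.
move=> mg_ mg bg cg.
have := @dominated_convergence _ _ _ P setT measurableT
  (fun n w => (g_ n w)%:E) (fun w => (g w)%:E) (cst M%:E).
case=> //.
- by move=> n; exact/measurable_EFinP.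
- exact/measurable_EFinP.
- apply: filterS cg => w cw _; apply/fine_cvgP; split; first exact: nearW.
  exact: cw.
- apply/integrableP; split; first exact: measurable_cst.
  by rewrite integral_cst//= probability_setT mule1 ltry.
- by apply: aeW => w n _; rewrite /= lee_fin.
Qed.

Lemma integral_le1_bounded (g : Omega -> R) (M : R) : measurable_fun setT g ->
  (forall w, 0 <= g w <= M) -> (0 <= \int[P]_w (g w)%:E <= M%:E)%E.
Proof.
move=> mg bg; apply/andP; split.
  by apply: integral_ge0 => w _; rewrite lee_fin; case/andP: (bg w).
apply: (@le_trans _ _ (\int[P]_w M%:E)%E); last first.
  by rewrite integral_cst//= probability_setT mule1.
apply: ge0_le_integral => //.
- by move=> w _; rewrite lee_fin; case/andP: (bg w).
- exact/measurable_EFinP.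
- by move=> w _; rewrite lee_fin; case/andP: (bg w).
Qed.

(** Truncation at a level [M >= K] loses at most [C / M] from each [g_ n], since
    [g_ n <= min (g_ n) M + g_ n ^ 2 / M], and does not affect the limit; the
    truncated functions obey bounded convergence. *)
Lemma square_bounded_cvg_integral (g_ : nat -> Omega -> R) (g : Omega -> R) (K C : R) :
  (forall n, measurable_fun setT (g_ n)) ->
  (forall n w, 0 <= g_ n w) ->
  (forall n, \int[P]_w (g_ n w)%:E = 1)%E ->
  (forall n, \int[P]_w (g_ n w ^+ 2)%:E <= C%:E)%E ->
  (forall w, g_ n w @[n --> \oo] --> g w) ->
  (forall w, 0 <= g w <= K) ->
  (\int[P]_w (g w)%:E = 1)%E.
Proof.
move=> mg_ g_0 ig_ ig2 cg gK.
have mg : measurable_fun setT g by apply: (measurable_fun_cvg mg_) => w _.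
have C0 : 0 <= C.
  rewrite -lee_fin; apply: le_trans (ig2 0%N); apply: integral_ge0 => w _.
  by rewrite lee_fin sqr_ge0.
have key M : 0 < M -> K <= M -> ((1 - C / M)%:E <= \int[P]_w (g w)%:E <= 1)%E.
  move=> M0 KM; pose h n w := Num.min (g_ n w) M.
  have mh n : measurable_fun setT (h n) by apply: measurable_minr.
  have h0 n w : 0 <= h n w by rewrite le_min g_0 ltW.
  have ch : (\int[P]_w (h n w)%:E @[n --> \oo] --> \int[P]_w (g w)%:E)%E.
    apply: (@bounded_cvg_integral h g M) => //.
      by move=> n w; rewrite ger0_norm// ge_min lexx orbT.
    apply: aeW => w; rewrite -[g w](_ : Num.min (g w) M = _); last first.
      by apply/min_idPl; case/andP: (gK w) => _ /le_trans; apply.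
    have cm : {for g w, continuous (fun y : R => Num.min y M)}.
      by apply: continuous_min; [exact: cvg_id|exact: cvg_cst].
    exact: (continuous_cvg _ cm (cg w)).
  have up n : (\int[P]_w (h n w)%:E <= 1)%E.
    rewrite -(ig_ n); apply: ge0_le_integral => //.
    - by move=> w _; rewrite lee_fin.
    - exact/measurable_EFinP.
    - exact/measurable_EFinP.
    - by move=> w _; rewrite lee_fin ge_min lexx.
  have low n : ((1 - C / M)%:E <= \int[P]_w (h n w)%:E)%E.
    have msq : measurable_fun setT (fun w => M^-1 * g_ n w ^+ 2).
      by apply: measurable_funM => //; exact: measurable_funX.
    have : (1 <= \int[P]_w (h n w)%:E + (C / M)%:E)%E.
      apply: (@le_trans _ _ (\int[P]_w ((h n w)%:E + (M^-1 * g_ n w ^+ 2)%:E))%E).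
        rewrite -(ig_ n); apply: ge0_le_integral => //.
        - by move=> w _; rewrite lee_fin.
        - exact/measurable_EFinP.
        - by apply: emeasurable_funD; exact/measurable_EFinP.
        - move=> w _; rewrite -EFinD lee_fin /h.
          have q0 : 0 <= M^-1 * g_ n w ^+ 2 by rewrite mulr_ge0 ?sqr_ge0// invr_ge0 ltW.
          case: (leP (g_ n w) M) => [_|Mg]; first by rewrite lerDl.
          have : g_ n w <= M^-1 * g_ n w ^+ 2.
            rewrite mulrC ler_pdivlMr// expr2 ler_wpM2l// ltW//.
          lra.
      rewrite ge0_integralD//; last 4 first.
      - by move=> w _; rewrite lee_fin.
      - exact/measurable_EFinP.
      - by move=> w _; rewrite lee_fin mulr_ge0 ?sqr_ge0// invr_ge0 ltW.
      - exact/measurable_EFinP.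
      apply: leeD2l; under eq_integral do rewrite EFinM.
      rewrite ge0_integralZl_EFin//; last 3 first.
      - by move=> w _; rewrite lee_fin sqr_ge0.
      - by apply/measurable_EFinP; exact: measurable_funX.
      - by rewrite invr_ge0 ltW.
      rewrite mulrC EFinM; apply: lee_wpmul2l => //.
      by rewrite lee_fin invr_ge0 ltW.
    by rewrite EFinB leeBlDr.
  apply/andP; split.
    rewrite -(cvg_lim _ ch)//; apply: lime_ge; first by apply/cvg_ex; eexists; exact: ch.
    exact: nearW.
  rewrite -(cvg_lim _ ch)//; apply: lime_le; first by apply/cvg_ex; eexists; exact: ch.
  exact: nearW.
pose M0 := Num.max K 1.
have M01 : 1 <= M0 by rewrite le_max lexx orbT.
have M0K : K <= M0 by rewrite le_max lexx.
have fI : (\int[P]_w (g w)%:E \is a fin_num)%E.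
  by have /andP[lo hi] := key M0 (lt_le_trans ltr01 M01) M0K; 
  by rewrite fin_numElt (lt_le_trans (ltNyr _) lo) (le_lt_trans hi (ltry _)).
move: key; rewrite -(fineK fI); set I := fine _ => key.
congr _%:E; apply/le_anti/andP; split.
  by have /andP[_] := key M0 (lt_le_trans ltr01 M01) M0K; rewrite lee_fin.
rewrite leNgt; apply/negP => I1.
(* Large enough for [C / M < 1 - I]. *)
pose M := M0 + (C + 1) / (1 - I).
have q0 : 0 < (C + 1) / (1 - I) by rewrite divr_gt0; lra.
have Mpos : 0 < M by rewrite /M; lra.
have := key M Mpos ltac:(rewrite /M; lra).
rewrite lee_fin => /andP[+ _].
have : C / M < 1 - I.
  rewrite ltr_pdivrMr// /M mulrDr mulrCA divff; last by rewrite gt_eqF//; lra.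
  have : 0 <= (1 - I) * M0 by rewrite mulr_ge0//; lra.
  lra.
lra.
Qed.

End integral_limits.

Section regulated_martingale.
Context (d : measure_display) (Omega : measurableType d) (R : realType)
  (P : probability Omega R) (X : R -> {RV P >-> R}) (phi : R -> R).
Hypothesis hX : spectrally_positive_levy X.
Hypothesis hphi : laplace_exponent X phi.
Hypothesis phi_ge0 : forall a : R, 0 <= a -> 0 <= phi a.

Local Notation path w := (fun s => X s w).
Local Notation L w := (regulator (path w)).

Context (theta : R -> R) (B C D : R).
Hypothesis theta_uc : uniformly_continuous theta.
Hypothesis kappa_uc : uniformly_continuous (phi \o theta).
Hypothesis theta_ge0 : forall y, 0 <= theta y.
Hypothesis theta_le : forall y, theta y <= B.
Hypothesis phi_theta_le : forall y, phi (theta y) <= B.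
Hypothesis measurable_phi2 : measurable_fun setT (phi \o (fun y => 2 * theta y)).
Hypothesis phi2_le : forall y, phi (2 * theta y) <= C.
Hypothesis primitive_le : forall y, 0 <= y -> primitive theta y <= D.

(** The exponent of [Z_t].  For constant [theta] it is
    [- theta * X_t - phi theta * t], that of Wald's martingale. *)
Definition regulated_exponent (t : R) (w : Omega) : R :=
  - theta (L w t) * reflected (path w) t + primitive theta (L w t) -
  primitive (phi \o theta \o L w) t.

Let path_cadlag w : cadlag (path w) := levy_cadlag hX w.
Let path_jumps w : no_negative_jumps (path w).
Proof. exact: levy_no_negative_jumps hX _. Qed.
Let path0 w : path w 0 = 0 := levy_start hX w.

Lemma regulated_exponent_le (t : R) (w : Omega) : 0 <= t ->
  regulated_exponent t w <= primitive theta (L w t) - primitive (phi \o theta \o L w) t.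
Proof.
move=> t0; rewrite /regulated_exponent.
have : 0 <= theta (L w t) * reflected (path w) t.
  rewrite mulr_ge0// /reflected.
  have := regulator_ubound (path_cadlag w) (@path_jumps w) (path0 w) t0 (lexx t); lra.
lra.
Qed.

Lemma clock_ge0 (t : R) (w : Omega) : 0 <= primitive (phi \o theta \o L w) t.
Proof. by apply: Rintegral_ge0 => s _ /=; exact: phi_ge0. Qed.

Lemma regulated_limit (t : R) (w : Omega) : 0 < t ->
  expR (- skeleton_exponent X phi (t / N.+1%:R) theta N.+1 w) @[N --> \oo] -->
  expR (regulated_exponent t w).
Proof.
move=> t0; apply: continuous_cvg; first exact: continuous_expR.
apply: (@skeleton_exponent_cvg R (path w) (path_cadlag w) (@path_jumps w) (path0 w)
    theta (phi \o theta) B t t0 theta_uc kappa_uc).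
- by move=> s; rewrite ger0_norm.
- by move=> s; rewrite ger0_norm//= phi_ge0.
Qed.

Lemma measurable_skeleton_weight (t : R) (N : nat) :
  measurable_fun setT (fun w => expR (- skeleton_exponent X phi (t / N.+1%:R) theta N.+1 w)).
Proof.
do 2 apply: measurableT_comp => //; apply: measurable_skeleton_exponent.
  exact: measurable_uc theta_uc.
exact: measurable_uc kappa_uc.
Qed.

Lemma measurable_regulated (t : R) : 0 < t ->
  measurable_fun setT (fun w => expR (regulated_exponent t w)).
Proof.
move=> t0; apply: (measurable_fun_cvg (measurable_skeleton_weight t)) => w _.
exact: regulated_limit.
Qed.

(** The square of the weight for [theta] is the weight for [2 * theta], of mean
    one, up to a factor at most [exp (C * t)]; hence the second moments are
    bounded along the grids. *)
Lemma regulated_mean (t : R) : 0 < t ->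
  (\int[P]_w (expR (regulated_exponent t w))%:E = 1)%E.
Proof.
move=> t0.
pose del (N : nat) := t / N.+1%:R.
have del0 N : 0 < del N by rewrite divr_gt0.
pose E th N w := expR (- skeleton_exponent X phi (del N) th N.+1 w).
have mth := measurable_uc theta_uc.
have mph := measurable_uc kappa_uc.
apply: (@square_bounded_cvg_integral _ _ _ P (E theta)
  (fun w => expR (regulated_exponent t w)) (expR D) (expR (C * t))) => //.
- by move=> N; exact: measurable_skeleton_weight.
- by move=> N w; exact: expR_ge0.
- by move=> N; apply: exponential_martingale.
- move=> N.
  have m2 : measurable_fun setT (fun y => 2 * theta y) by exact: measurable_funM.
  have th2 y : 0 <= 2 * theta y by rewrite mulr_ge0.
  have := exponential_martingale hX hphi (del0 N) N.+1 m2 measurable_phi2 th2.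
  have mE2 : measurable_fun setT (E (fun y => 2 * theta y) N).
    by do 2 apply: measurableT_comp => //; exact: measurable_skeleton_exponent.
  move=> h; rewrite -[leRHS]mule1 -h -ge0_integralZl_EFin ?expR_ge0//; last first.
    exact/measurable_EFinP.
  apply: ge0_le_integral => //.
  + by move=> w _; rewrite lee_fin sqr_ge0.
  + by apply/measurable_EFinP; apply: measurable_funX; exact: measurable_skeleton_weight.
  + by apply/measurable_EFinP; exact: measurable_funM.
  move=> w _; rewrite -EFinM lee_fin /E expr2 -!expRD ler_expR.
  suff : skeleton_exponent X phi (del N) (fun y => 2 * theta y) N.+1 w <=
     2 * skeleton_exponent X phi (del N) theta N.+1 w + C * t by lra.
  have -> : C * t = \sum_(j < N.+1) C * del N.
    by rewrite sumr_const card_ord -mulr_natl mulrCA [_ * del N]mulrCA divff ?mulr1// .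
  rewrite /skeleton_exponent mulr_sumr -big_split/=; apply: ler_sum => j _.
  set a := running_max _ _.
  have h1 : 0 <= phi (theta a) * del N by rewrite mulr_ge0 ?phi_ge0// ltW.
  have h2 : phi (2 * theta a) * del N <= C * del N by rewrite ler_pM2r.
  lra.
- by move=> w; exact: regulated_limit.
- move=> w; rewrite expR_ge0/= ler_expR.
  apply: le_trans (regulated_exponent_le w (ltW t0)) _.
  have := clock_ge0 t w.
  have := primitive_le (regulator_ge0 (path_cadlag w) (@path_jumps w) (path0 w) (ltW t0)).
  lra.
Qed.

End regulated_martingale.

(** * Functions of compact support and their approximation *)

Section compact_support.
Context (R : realType) (u : R -> R) (M : R).
Hypothesis u_cont : continuous u.
Hypothesis u_supp : forall y, M <= `|y| -> u y = 0.

Lemma compact_support_uniformly_continuous : uniformly_continuous u.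
Proof.
move=> e e0.
pose Q (eta y : R) := forall b, `|y - b| < eta -> `|u y - u b| <= e.
have ncov : near_covering (`[- M - 1, M + 1]%classic : set R).
  by apply/compact_near_coveringP; exact: segment_compact.
have cover : forall y, `[- M - 1, M + 1]%classic y ->
    \forall y' \near y & eta \near (0:R)^'+, Q eta y'.
  move=> y _.
  have e2 : 0 < e / 2 by lra.
  have /cvgrPdist_le /(_ _ e2) [eta /= eta0 h] := u_cont (x := y).
  exists ([set y' | `|y - y'| < eta / 2], [set r : R | r < eta / 2]) => /=.
    split; first by exists (eta / 2) => /=; [lra|].
    by apply: nbhs_right_lt; lra.
  move=> [y' r] /= [yy' re] b y'b.
  have h1 : `|u y - u y'| <= e / 2 by apply: h => /=; lra.
  have h2 : `|u y - u b| <= e / 2.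
    by apply: h => /=; have := ler_distD y' y b; lra.
  by have := ler_distD (u y) (u y') (u b); rewrite (distrC (u y') (u y)); lra.
have [eta /= eta0 h] := ncov _ _ _ (at_right_proper_filter (0:R)) cover.
pose r := Num.min 1 (eta / 2).
have r0 : 0 < r by rewrite lt_min ltr01/=; lra.
have r1 : r <= 1 by rewrite ge_min lexx.
have r2 : r <= eta / 2 by rewrite ge_min lexx orbT.
exists r => // a b ab.
have [aM|aM] := leP `|a| (M + 1).
  have hQ : `[- M - 1, M + 1]%classic `<=` Q (eta / 2).
    have e2 : 0 < eta / 2 by lra.
    by apply: h => //=; rewrite sub0r normrN gtr0_norm//; lra.
  apply: (hQ a); last by lra.
  by move: aM; rewrite /= in_itv/= ler_norml => /andP[? ?]; apply/andP; split; lra.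
rewrite !u_supp ?subrr ?normr0 ?ltW//.
- by have := ler_normD (a - b) b; rewrite subrK; lra.
- by lra.
Qed.

Context (B : R).
Hypothesis M_ge0 : 0 <= M.
Hypothesis u_ge0 : forall y, 0 <= u y.
Hypothesis u_le : forall y, u y <= B.

Let mu : measurable_fun setT u := measurable_uc compact_support_uniformly_continuous.
Let u_bounded y : `|u y| <= B.
Proof. by rewrite ger0_norm. Qed.

Lemma primitive_stationary (y : R) : M <= y -> primitive u y = primitive u M.
Proof.
move=> My; have := @primitive_increment _ u B mu u_bounded M y 0 0 M_ge0 My.
rewrite !mul0r subr0 normr_le0 subr_eq0 => h; apply/eqP/h => s Ms _.
by rewrite u_supp ?subrr ?normr0// (le_trans Ms)// ler_norm.
Qed.

Lemma primitive_bounded (y : R) : 0 <= y -> primitive u y <= B * M.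
Proof.
move=> y0; have B0 : 0 <= B by exact: le_trans (u_ge0 0) (u_le 0).
have h z : 0 <= z -> z <= M -> primitive u z <= B * M.
  move=> z0 zM; apply: (@le_trans _ _ (B * z)); last exact: ler_wpM2l.
  have := primitive_lipschitz mu u_bounded (lexx 0) z0.
  by rewrite primitive0 !subr0 => /(le_trans (ler_norm _)).
have [yM|/ltW My] := leP y M; first exact: h.
by rewrite primitive_stationary// h.
Qed.

End compact_support.

Section trapezoid.
Context (R : realType).

Definition trapezoid (x y : R) : R := Num.min 1 (Num.max 0 (x + 1 - `|y|)).

Lemma trapezoid_continuous x : continuous (trapezoid x).
Proof.
move=> y; apply: (@continuous_min _ _ (cst 1) (fun z => Num.max 0 (x + 1 - `|z|))).
  exact: cvg_cst.
apply: (@continuous_max _ _ (cst 0) (fun z => x + 1 - `|z|)); first exact: cvg_cst.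
by apply: cvgB; [exact: cvg_cst|exact: norm_continuous].
Qed.

Lemma trapezoid_ge0 x y : 0 <= trapezoid x y.
Proof. by rewrite /trapezoid le_min ler01 le_max lexx. Qed.

Lemma trapezoid_le1 x y : trapezoid x y <= 1.
Proof. by rewrite /trapezoid ge_min lexx. Qed.

Lemma trapezoid_supp x y : x + 1 <= `|y| -> trapezoid x y = 0.
Proof.
move=> xy; rewrite /trapezoid (_ : Num.max 0 _ = 0) ?(min_idPr _)//.
by apply/max_idPl; lra.
Qed.

Lemma trapezoid_eq1 x y : `|y| <= x -> trapezoid x y = 1.
Proof.
by move=> yx; apply/min_idPl; rewrite le_max; apply/orP; right; lra.
Qed.

End trapezoid.

Section damping.
Context (R : realType).

(** [exp (- x)] for [x] in [[0, +oo]] as a real number, so that limits and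
    integrals can be taken in the reals; it vanishes at [+oo]. *)
Definition damp (x : \bar R) : R := fine (expeR (- x)).

Lemma damp_fin (r : R) : damp r%:E = expR (- r).
Proof. by []. Qed.

Lemma dampE (x : \bar R) : (0 <= x)%E -> (damp x)%:E = expeR (- x).
Proof. by case: x => //= _. Qed.

Lemma damp_ge0 (x : \bar R) : 0 <= damp x.
Proof. by case: x => //= r; exact: expR_ge0. Qed.

Lemma damp_le1 (x : \bar R) : (0 <= x)%E -> damp x <= 1.
Proof.
case: x => [r| |] //=; rewrite lee_fin /damp /= => r0.
by rewrite -[leRHS]expR0 ler_expR oppr_le0.
Qed.

Lemma measurable_damp : measurable_fun setT damp.
Proof.
rewrite (_ : damp = fun x => expR (- fine x) * \1_[set y : \bar R | y \is a fin_num] x).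
  apply: measurable_funM.
    by do 2 apply: measurableT_comp => //; exact: fine_measurable.
  apply: measurable_indic.
  rewrite -[X in measurable X]setTI; exact: emeasurable_fin_num.
apply/funext => -[r| |]; rewrite /damp indicE /=.
- by rewrite mem_set// mulr1.
- by rewrite memNset// mulr0.
- by rewrite memNset// mulr0.
Qed.

Lemma dampD (x y : \bar R) : (0 <= x)%E -> (0 <= y)%E -> damp (x + y) = damp x * damp y.
Proof.
case: x y => [r| |] [s| |] //= r0 s0; rewrite /damp /= ?mulr0 ?mul0r//.
by rewrite opprD expRD.
Qed.

Lemma damp_le (x y : \bar R) : (0 <= x)%E -> (x <= y)%E -> damp y <= damp x.
Proof.
case: x y => [r| |] [s| |] //=; rewrite ?lee_fin /damp/= => r0 rs.
  by rewrite ler_expR lerN2.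
exact: expR_ge0.
Qed.

Lemma damp_cvg (x_ : nat -> \bar R) (x : \bar R) :
  (forall n, (0 <= x_ n)%E) -> x_ n @[n --> \oo] --> x -> damp (x_ n) @[n --> \oo] --> damp x.
Proof.
move=> x0; case: x => [r| |] h.
- have [hfin hr] := (fine_cvgP _ _).1 h.
  have hN : - fine (x_ n) @[n --> \oo] --> - r by exact: cvgN.
  have := cvg_comp _ _ hN (@continuous_expR R (- r)).
  apply: cvg_trans; apply: near_eq_cvg; apply: filterS hfin => n /=.
  by case: (x_ n).
- rewrite {2}/damp /=; apply/cvgrPdist_le => /= e e0.
  have /cvgeyPge /(_ (- ln e)) := h; apply: filterS => n hn.
  rewrite sub0r normrN ger0_norm ?damp_ge0//.
  move: (x0 n) hn; case: (x_ n) => [s| |] //= s0.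
    by rewrite lee_fin /damp /= => hs; rewrite -[leRHS]lnK// ler_expR; lra.
  by move=> *; rewrite /damp /=; exact: ltW.
- exfalso; have : (0 <= -oo :> \bar R)%E.
    rewrite -(cvg_lim _ h)//; apply: lime_ge; last exact: nearW.
    by apply/cvg_ex; eexists; exact: h.
  by [].
Qed.

Lemma expRN_lipschitz (a b : R) : 0 <= a -> 0 <= b -> expR (- a) - expR (- b) <= `|a - b|.
Proof.
move=> a0 b0; have [ab|/ltW ba] := leP a b; last first.
  by rewrite (@le_trans _ _ 0)// subr_le0 ler_expR lerN2.
have -> : expR (- b) = expR (- a) * expR (- (b - a)).
  by rewrite -expRD; congr expR; ring.
have h1 : 1 + - (b - a) <= expR (- (b - a)) by exact: expR_ge1Dx.
have h2 : expR (- a) <= 1 by rewrite -[leRHS]expR0 ler_expR; lra.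
have h3 : 0 < expR (- a) by exact: expR_gt0.
rewrite distrC ger0_norm ?subr_ge0//.
rewrite -[X in X - _]mulr1 -mulrBr.
apply: (@le_trans _ _ (expR (- a) * (b - a))); first by rewrite ler_pM2l//; lra.
by rewrite -[leRHS]mul1r ler_wpM2r// subr_ge0.
Qed.

End damping.

Section distance_to_set.
Context (R : realType) (A : set R).
Hypothesis A_neq0 : A !=set0.

Definition dist_to (y : R) : R := inf [set `|y - z| | z in A].

Let lb y : has_lbound [set `|y - z| | z in A].
Proof. by exists 0 => _ [z _ <-]. Qed.

Let ne y : [set `|y - z| | z in A] !=set0.
Proof. by have [z Az] := A_neq0; exists `|y - z|, z. Qed.

Lemma dist_to_ge0 y : 0 <= dist_to y.
Proof. by apply: lb_le_inf => // _ [z _ <-]. Qed.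

Lemma dist_to_le y z : A z -> dist_to y <= `|y - z|.
Proof. by move=> Az; apply: ge_inf => //; exists z. Qed.

Lemma dist_to_eq0 y : A y -> dist_to y = 0.
Proof.
move=> Ay; apply/le_anti; rewrite dist_to_ge0 andbT.
by have := dist_to_le y Ay; rewrite subrr normr0.
Qed.

Lemma dist_to_gt0 y : open (~` A) -> ~ A y -> 0 < dist_to y.
Proof.
move=> oA nAy; have := oA y nAy => -[e /= e0 he].
apply: (lt_le_trans e0); apply: lb_le_inf => // _ [z Az <-].
by rewrite leNgt; apply/negP => yz; exact: (he z yz).
Qed.

Lemma dist_to_continuous : continuous dist_to.
Proof.
apply: lipschitz_near_continuous => a; exists 1 => // b _; rewrite mul1r.
have h s t : dist_to s - dist_to t <= `|s - t|.
  rewrite lerBlDr -lerBlDl; apply: lb_le_inf => // _ [z Az <-].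
  by rewrite lerBlDl; apply: le_trans (dist_to_le s Az) _; exact: ler_distD.
by rewrite ler_norml lerNl opprB h andbT distrC h.
Qed.

End distance_to_set.

Section continuous_approximation.
Context (R : realType).
Local Notation leb := (@lebesgue_measure R).

(** Lusin's theorem provides a compact [K] inside [[0, M]] on which [u] is
    continuous, up to measure [eps / 2].  Together with two closed half lines a
    little beyond 0 and [M], on which [u] vanishes, [K] forms a closed set to
    which Tietze's theorem applies; this also makes [g] of compact support, and
    [U] is the complement. *)
Lemma bounded_continuous_approximation (u : R -> R) (B M eps : R) :
  measurable_fun setT u -> (forall y, 0 <= u y <= B) -> 0 < B -> 0 <= M ->
  (forall y, ~ (0 <= y <= M) -> u y = 0) -> 0 < eps ->
  exists g : R -> R, exists U : set R,
  [/\ continuous g, forall y, 0 <= g y <= B, forall y, M + 1 <= `|y| -> g y = 0 &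
   [/\ open U, forall y, U y -> `|y| < M + 1, (leb U <= eps%:E)%E &
       forall y, ~ U y -> u y = g y]].
Proof.
move=> mu uB B0 M0 u0 eps0.
have mA : measurable (`[0, M]%classic : set R) by [].
have Aoo : (leb `[0%R, M] < +oo)%E by rewrite lebesgue_measure_itv/=; case: ifP; rewrite ltry.
have e2 : 0 < eps / 2 by lra.
have [K [cK KA lK uK]] := measurable_almost_continuous mA Aoo e2 (measurable_funTS mu).
pose eta := Num.min (1 / 2) (eps / 4).
have eta0 : 0 < eta by rewrite lt_min; apply/andP; split; lra.
have eta1 : eta <= 1 / 2 by rewrite ge_min lexx.
have eta2 : eta <= eps / 4 by rewrite ge_min lexx orbT.
pose out := [set y : R | y <= - eta] `|` [set y | M + eta <= y].
have cout : closed out by apply: closedU; [exact: closed_le|exact: closed_ge].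
have clK : closed K by apply: compact_closed => //; exact: Rhausdorff.
pose K' := K `|` out.
have cK' : closed K' by exact: closedU.
have uout y : out y -> u y = 0.
  by move=> [] /= h; apply: u0 => /andP[? ?]; lra.
have uK' : {within K', continuous u}.
  apply: withinU_continuous => //.
  have c0 : {within out, continuous (cst 0 : R -> R)}.
    by apply: continuous_subspaceT => y; exact: cvg_cst.
  apply: subspace_eq_continuous c0 => y yo.
  by apply/esym; apply: uout; exact: set_mem.
have uB' y : K' y -> `|u y| <= B.
  by move=> _; have /andP[? ?] := uB y; rewrite ger0_norm.
have [g0 [g0u cg0 g0B]] := continuous_bounded_extension (@pseudometric_normal _ R) cK' B0 uK' uB'.
exists (fun y => Num.max 0 (g0 y)), (~` K'); split.
- move=> y; apply: (@continuous_max _ _ (cst 0) g0); first exact: cvg_cst.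
  exact: cg0.
- move=> y; rewrite le_max lexx/= ge_max ltW//=.
  by apply: le_trans (g0B y); exact: ler_norm.
- move=> y yM; have yo : out y.
    have [y0|y0] := leP 0 y.
      by right => /=; rewrite ger0_norm in yM => //; lra.
    by left => /=; rewrite ltr0_norm in yM => //; lra.
  by rewrite -g0u ?uout ?maxxx// inE; right.
split.
- exact: closed_openC.
- move=> y nK; rewrite ltNge; apply/negP => yM; apply: nK; right.
  have [y0|y0] := leP 0 y.
    by right => /=; rewrite ger0_norm in yM => //; lra.
  by left => /=; rewrite ltr0_norm in yM => //; lra.
- have sub : ~` K' `<=` (`[0, M] `\` K) `|` (`]- eta, 0[ `|` `]M, M + eta[).
    move=> y; rewrite /K' setCU => -[nK no].
    have y1 : - eta < y by rewrite ltNge; apply/negP => h; apply: no; left.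
    have y2 : y < M + eta by rewrite ltNge; apply/negP => h; apply: no; right.
    have [y0|y0] := ltP y 0; first by right; left => /=; rewrite in_itv/= y1.
    have [yM|yM] := ltP M y; first by right; right => /=; rewrite in_itv/= yM.
    by left; split => //=; rewrite in_itv/= y0.
  have mK : measurable K by exact: closed_measurable.
  apply: (@le_trans _ _ (leb ((`[0, M] `\` K) `|` (`]- eta, 0[ `|` `]M, M + eta[)))).
    apply: le_measure => //; rewrite inE.
      by apply: open_measurable; exact: closed_openC.
    by apply: measurableU; [exact: measurableD|exact: measurableU].
  apply: (le_trans (measureU2 _ _ _)).
  + exact: measurableD.
  + exact: measurableU.
  apply: (@le_trans _ _ ((eps / 2)%:E + (eta%:E + eta%:E))%E); last first.
    by rewrite -!EFinD lee_fin; lra.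
  apply: leeD; first exact: ltW.
  apply: (le_trans (measureU2 _ _ _)) => //.
  have itv_le a b : b - a <= eta -> (leb `]a, b[%classic <= eta%:E)%E.
    move=> abe; rewrite lebesgue_measure_itv/= lte_fin; case: ifP => _.
      by rewrite -EFinD lee_fin.
    by rewrite lee_fin ltW.
  by apply: leeD; apply: itv_le; lra.
- move=> y nU; have K'y : K' y by apply: contrapT => h; exact: nU.
  rewrite -g0u ?inE//; apply/esym/max_idPr.
  by have /andP[] := uB y.
Qed.

End continuous_approximation.

(** * The Laplace functional of the regulator *)

Section laplace_functional.
Context (d : measure_display) (Omega : measurableType d) (R : realType)
  (P : probability Omega R) (X : R -> {RV P >-> R}) (phi : R -> R).
Hypothesis hX : spectrally_positive_levy X.
Hypothesis hphi : laplace_exponent X phi.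
Hypothesis phi0 : phi 0 = 0.
Hypothesis phi_le : forall a b : R, 0 <= a -> a <= b -> phi a <= phi b.
Hypothesis phi_gt0 : forall a : R, 0 < a -> 0 < phi a.
Hypothesis phi_cont : continuous (phi \o Num.max 0).

Local Notation leb := (@lebesgue_measure R).
Local Notation path w := (fun s => X s w).
Local Notation L w := (regulator (path w)).

Let path_cadlag w : cadlag (path w) := levy_cadlag hX w.
Let path_jumps w : no_negative_jumps (path w).
Proof. exact: levy_no_negative_jumps hX _. Qed.
Let path0 w : path w 0 = 0 := levy_start hX w.
Let phi_ge0 (a : R) : 0 <= a -> 0 <= phi a.
Proof. by move=> a0; rewrite -phi0 phi_le. Qed.
Let L_ge0 w t : 0 <= t -> 0 <= L w t.
Proof. exact: regulator_ge0. Qed.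

(** The integral of [kappa] against the image of Lebesgue measure by the
    regulator, that is, against the measure [dT_y]. *)
Definition occupation (kappa : R -> R) (w : Omega) : \bar R :=
  (\int[lebesgue_measure]_(s in `[0%R, +oo[) (kappa (L w s))%:E)%E.

(** Rational times are enough: a path without negative jumps that lies below a
    level at a time [v > 0] lies below it just before [v]. *)
Lemma regulator_gtP (w : Omega) (a t : R) : 0 <= a ->
  (a < L w t <-> exists q : rat, [/\ 0 <= ratr q :> R, ratr q <= t & X (ratr q) w < - a]).
Proof.
move=> a0; split; last first.
  move=> [q [q0 qt Xq]].
  have := regulator_ubound (path_cadlag w) (@path_jumps w) (path0 w) q0 qt; lra.
move=> aL.
have t0 : 0 <= t.
  rewrite leNgt; apply/negP => t0.
  have := regulator_nondecreasing (path_cadlag w) (@path_jumps w) (path0 w) (ltW t0).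
  have L0 : L w 0 <= 0.
    apply: regulator_least => // s s0 s0'.
    by rewrite (_ : s = 0) ?path0 ?oppr0//; apply/le_anti; rewrite s0'.
  lra.
have [v [v0 vt Xv]] : exists v, [/\ 0 <= v, v <= t & X v w < - a].
  apply: contrapT => h; suff : L w t <= a by rewrite leNgt aL.
  apply: regulator_least => // s s0 st; rewrite leNgt; apply/negP => Xs.
  by apply: h; exists s; split => //; lra.
have v0' : 0 < v.
  rewrite lt_neqAle v0 andbT; apply/eqP => v0E.
  by move: Xv; rewrite -v0E (levy_start hX); lra.
have e0 : 0 < (- a - X v w) / 2 by lra.
have [eta eta0 h] := local_lower_modulus (path_cadlag w) (@path_jumps w) v0 e0.
have mv : Num.max 0 (v - eta) < v by rewrite gt_max v0'/=; lra.
have [q] := rat_in_itvoo mv; rewrite in_itv/= gt_max => /andP[/andP[q0 qe] qv].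
exists q; split; [exact: ltW|exact: le_trans (ltW qv) vt|].
have := h (ratr q) v (ltW q0) (ltW qv) qe ltac:(lra); lra.
Qed.

Lemma measurable_regulator_joint :
  measurable_fun setT (fun z : Omega * R => L z.1 z.2).
Proof.
move=> mT; apply: (measurability _ (RGenOInfty.measurableE R)) => //.
move=> _ [_ [a ->] <-]; rewrite setTI.
have [a0|a0] := leP 0 a; last first.
  rewrite (_ : _ @^-1` _ = setT)// -subTset => -[w t] _ /=.
  rewrite in_itv/= andbT; apply: (lt_le_trans a0).
  have [t0|t0] := leP 0 t; first exact: regulator_ge0.
  by rewrite regulator_lt0.
rewrite (_ : _ @^-1` _ = \bigcup_q
    (if 0 <= ratr q :> R then [set w | X (ratr q) w < - a] `*` `[ratr q, +oo[%classic
     else set0)).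
  apply: bigcupT_measurable_rat => q; case: ifPn => // _.
  apply: measurableX => //.
  rewrite -[X in measurable X]setTI -[X in setT `&` X]/(X (ratr q) @^-1` [set y | y < - a]).
  rewrite -set_itvNyo.
  exact: measurable_funP.
apply/seteqP; split=> [[w t] /=|[w t] /= [q _]].
  rewrite in_itv/= andbT => /(regulator_gtP w t a0)[q [q0 qt Xq]].
  by exists q => //; rewrite q0; split => //=; rewrite in_itv/= qt.
case: ifPn => // q0 [/= Xq]; rewrite !in_itv/= !andbT => qt.
by apply/(regulator_gtP w t a0); exists q.
Qed.

Lemma measurable_regulator_at (t : R) : measurable_fun setT (fun w => L w t).
Proof.
have mp : measurable_fun setT (fun w : Omega => (w, t)).
  by apply: measurable_fun_pair => //; exact: measurable_cst.
exact: (measurableT_comp measurable_regulator_joint mp).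
Qed.

Lemma measurable_occupation (kappa : R -> R) : measurable_fun setT kappa ->
  (forall y, 0 <= y -> 0 <= kappa y) -> measurable_fun setT (occupation kappa).
Proof.
move=> mk k0.
pose F (z : Omega * R) := (kappa (L z.1 z.2) * \1_`[0%R, +oo[%classic z.2)%:E.
have F0 z : (0 <= F z)%E.
  rewrite lee_fin /F indicE; case: (boolP (z.2 \in _)) => [|_]; last by rewrite mulr0.
  rewrite inE/= in_itv/= andbT mulr1 => z0; apply: k0.
  exact: regulator_ge0.
have mF : measurable_fun setT F.
  apply/measurable_EFinP; apply: measurable_funM.
    by apply: measurableT_comp => //; exact: measurable_regulator_joint.
  apply: (measurableT_comp (f := \1_`[0%R, +oo[%classic : R -> R)) => //.
have := @measurable_fun_fubini_tonelli_F _ _ Omega (measurableTypeR R) R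
  (@lebesgue_measure R) F mF F0.
apply: eq_measurable_fun => w _; rewrite /fubini_F [RHS]integral_mkcond.
apply: eq_integral => s _; rewrite /F /= patchE indicE.
by case: (s \in _); rewrite ?mulr1 ?mulr0.
Qed.

Lemma exponent_comp_continuous (theta : R -> R) : continuous theta ->
  (forall y, 0 <= theta y) -> continuous (phi \o theta).
Proof.
move=> ct th0; rewrite (_ : phi \o theta = (phi \o Num.max 0) \o theta).
  by move=> y; apply: continuous_comp; [exact: ct|exact: phi_cont].
by apply/funext => y /=; rewrite (max_idPr (th0 y)).
Qed.

Section compactly_supported_weight.
Context (theta : R -> R) (B M : R).
Hypothesis theta_cont : continuous theta.
Hypothesis theta_supp : forall y, M <= `|y| -> theta y = 0.
Hypothesis M_ge0 : 0 <= M.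
Hypothesis theta_ge0 : forall y, 0 <= theta y.
Hypothesis theta_le : forall y, theta y <= B.

Lemma weight_uc : uniformly_continuous theta.
Proof. exact: compact_support_uniformly_continuous theta_cont theta_supp. Qed.

Lemma kappa_uc : uniformly_continuous (phi \o theta).
Proof.
apply: (@compact_support_uniformly_continuous _ _ M).
  exact: exponent_comp_continuous.
by move=> y /theta_supp /= ->.
Qed.

Lemma regulated_mean_compact (t : R) : 0 < t ->
  (\int[P]_w (expR (regulated_exponent X phi theta t w))%:E = 1)%E.
Proof.
apply: (@regulated_mean _ _ _ P X phi hX hphi phi_ge0 theta (Num.max B (phi B))
  (phi (2 * B)) (B * M)) => //.
- exact: weight_uc.
- exact: kappa_uc.
- by move=> y; rewrite le_max theta_le.
- by move=> y; rewrite le_max phi_le ?orbT.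
- apply: continuous_measurable_fun; apply: exponent_comp_continuous.
    by move=> y; apply: cvgMr; exact: theta_cont.
  by move=> y; rewrite mulr_ge0.
- by move=> y; rewrite phi_le ?mulr_ge0// ler_pM2l.
- by move=> y; apply: primitive_bounded.
Qed.

Lemma measurable_regulated_compact (t : R) : 0 < t ->
  measurable_fun setT (fun w => expR (regulated_exponent X phi theta t w)).
Proof.
apply: (@measurable_regulated _ _ _ P X phi hX phi_ge0 theta (Num.max B (phi B))) => //.
- exact: weight_uc.
- exact: kappa_uc.
- by move=> y; rewrite le_max theta_le.
- by move=> y; rewrite le_max phi_le ?orbT.
Qed.

End compactly_supported_weight.

Definition exceeds (x : R) : set Omega := [set w | exists n : nat, x < L w n%:R].

Lemma measurable_exceeds x : measurable (exceeds x).
Proof.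
rewrite (_ : exceeds x = \bigcup_n [set w | x < L w n%:R]); last first.
  by apply/seteqP; split=> [w [n hn]|w [n _ hn]]; exists n.
apply: bigcupT_measurable => n; rewrite -[X in measurable X]setTI.
rewrite -[X in setT `&` X]/((fun w => L w n%:R) @^-1` [set y | x < y]) -set_itvoy.
exact: measurable_regulator_at.
Qed.

(** The mean-one identity for the weight equal to [e] up to level [x] and then
    decreasing to 0 at [x + 1].  [Z_t] is at most [exp (e * (x + 1))] always,
    and at most [exp (e * x - phi e * t)] while [L] has not passed [x]. *)
Lemma trapezoid_escape (x e t : R) : 0 <= x -> 0 < e -> 0 < t ->
  (1 <= (expR (e * (x + 1)))%:E * P (exceeds x) +
        (expR (e * x - phi e * t))%:E)%E.
Proof.
move=> x0 e0 t0.
pose theta y := e * trapezoid x y.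
have x1 : 0 <= x + 1 by lra.
have th_cont : continuous theta.
  by move=> y; apply: cvgMr; exact: trapezoid_continuous.
have th_supp y : x + 1 <= `|y| -> theta y = 0.
  by move=> /trapezoid_supp; rewrite /theta => ->; rewrite mulr0.
have th0 y : 0 <= theta y by rewrite mulr_ge0 ?trapezoid_ge0 ?ltW.
have the y : theta y <= e by rewrite -[leRHS]mulr1 ler_pM2l// trapezoid_le1.
set A := exceeds x; have mA : measurable A := measurable_exceeds x.
rewrite -(regulated_mean_compact th_cont th_supp x1 th0 the t0).
have -> : ((expR (e * (x + 1)))%:E * P A + (expR (e * x - phi e * t))%:E =
   \int[P]_w ((expR (e * (x + 1)) * \1_A w)%:E + (expR (e * x - phi e * t))%:E))%E.
  rewrite ge0_integralD//; last first.
    by apply/measurable_EFinP; exact: measurable_funM.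
  rewrite integral_cst//= probability_setT mule1; congr (_ + _)%E.
  under eq_integral do rewrite EFinM.
  rewrite ge0_integralZl_EFin ?expR_ge0//=; last exact/measurable_EFinP.
  by rewrite integral_indic// setIT.
apply: ge0_le_integral => //.
- by apply/measurable_EFinP; exact: (measurable_regulated_compact th_cont th_supp).
- apply: emeasurable_funD => //.
  by apply/measurable_EFinP; exact: measurable_funM.
move=> w _; rewrite -EFinD lee_fin.
have Lt0 := L_ge0 w (ltW t0).
have h1 := regulated_exponent_le phi hX th0 w (ltW t0).
have th_uc := weight_uc th_cont th_supp.
have mth := measurable_uc th_uc.
have thb y : `|theta y| <= e by rewrite ger0_norm.
have cl0 : 0 <= primitive (phi \o theta \o L w) t by exact: clock_ge0.
rewrite indicE; have [wA|wA] := boolP (w \in A).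
  rewrite mulr1 -[leLHS]addr0 lerD ?expR_ge0// ler_expR.
  have := primitive_bounded th_cont th_supp x1 th0 the Lt0; lra.
rewrite mulr0 add0r ler_expR.
have Lx s : 0 <= s -> L w s <= x.
  move=> s0; rewrite leNgt; apply/negP => xs; move/negP: wA; apply.
  rewrite inE; exists (Num.truncn s).+1; apply: (lt_le_trans xs).
  by apply: regulator_le => //; exact: ltW (truncnS_gt s).
have h2 : primitive theta (L w t) <= e * x.
  apply: (@le_trans _ _ (e * L w t)); last by rewrite ler_pM2l// Lx// ltW.
  have := primitive_lipschitz mth thb (lexx 0) Lt0.
  by rewrite primitive0 !subr0 => /(le_trans (ler_norm _)).
have h3 : primitive (phi \o theta \o L w) t = phi e * t.
  rewrite /primitive (@eq_Rintegral _ _ _ _ _ (cst (phi e))); last first.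
    move=> s; rewrite inE/= in_itv/= => /andP[s0 _].
    by rewrite /theta trapezoid_eq1 ?mulr1// ger0_norm ?Lx// L_ge0.
  rewrite Rintegral_cst//= lebesgue_measure_itv/= lte_fin t0 -EFinD/=.
  by rewrite subr0.
lra.
Qed.

(** Let first [t] tend to infinity and then [e] to 0 in [trapezoid_escape]: the
    probability that [L] passes [x] is at least one. *)
Lemma regulator_unbounded (x : R) : 0 <= x ->
  {ae P, forall w, exists n : nat, x < L w n%:R}.
Proof.
move=> x0.
set A := exceeds x; have mA : measurable A := measurable_exceeds x.
have fA : P A \is a fin_num by exact: fin_num_measure.
set p := fine (P A).
have pE : P A = p%:E by rewrite /p fineK.
have stepe e : 0 < e -> 1 <= expR (e * (x + 1)) * p.
  move=> e0.
  pose z := expR (- phi e).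
  have z1 : `|z| < 1.
    by rewrite ger0_norm ?expR_ge0// -[ltRHS]expR0 ltr_expR oppr_lt0 phi_gt0.
  have ineq n : 1 <= expR (e * (x + 1)) * p + expR (e * x) * (z * z ^+ n).
    have := trapezoid_escape x0 e0 (ltr0Sn R n).
    rewrite -/A pE -EFinM -EFinD lee_fin.
    suff -> : expR (e * x - phi e * n.+1%:R) = expR (e * x) * (z * z ^+ n) by [].
    by rewrite expRD -exprS /z -expRM_natl; congr (_ * expR _); ring.
  have cv : (expR (e * (x + 1)) * p + expR (e * x) * (z * z ^+ n))
      @[n --> \oo] --> expR (e * (x + 1)) * p + expR (e * x) * (z * 0).
    apply: cvgD; first exact: cvg_cst.
    by do 2 apply: cvgMr; exact: cvg_expr.
  rewrite !mulr0 addr0 in cv.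
  rewrite -(cvg_lim (@Rhausdorff R) cv); apply: limr_ge.
    by apply/cvg_ex; eexists; exact: cv.
  exact: nearW.
have p1 : 1 <= p.
  have h0 : (n.+1%:R^-1 * (x + 1)) @[n --> \oo] --> (0 : R).
    by rewrite -(mul0r (x + 1)); apply: cvgMl; exact: cvg_harmonic.
  have h1 := cvg_comp _ _ h0 (@continuous_expR R 0); rewrite expR0 in h1.
  have h2 : ((expR \o (fun n : nat => n.+1%:R^-1 * (x + 1))) n * p) @[n --> \oo] --> 1 * p.
    by apply: cvgMl; exact: h1.
  rewrite -[leRHS]mul1r -(cvg_lim (@Rhausdorff R) h2); apply: limr_ge.
    by apply/cvg_ex; eexists; exact: h2.
  by apply: nearW => n /=; apply: stepe; rewrite invr_gt0.
have pA : P A = 1%E.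
  by apply/le_anti; rewrite probability_le1//= pE lee_fin.
exists (~` A); split; first exact: measurableC.
  by rewrite probability_setC// pA subee.
by apply: subsetC => w.
Qed.

Lemma occupation_ge0 (kappa : R -> R) (w : Omega) :
  (forall y, 0 <= y -> 0 <= kappa y) -> (0 <= occupation kappa w)%E.
Proof.
move=> k0; apply: integral_ge0 => s /=; rewrite in_itv/= andbT => s0.
by rewrite lee_fin k0// regulator_ge0.
Qed.

(** Once [L] has passed [M], nothing in the exponent of [Z_t] moves any more;
    its value is then [primitive theta M - occupation (phi \o theta)]. *)
Lemma laplace_functional_compact (theta : R -> R) (B M : R) :
  continuous theta -> (forall y, M <= `|y| -> theta y = 0) -> 0 <= M ->
  (forall y, 0 <= theta y) -> (forall y, theta y <= B) ->
  (\int[P]_w (damp (occupation (phi \o theta) w))%:E =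
   (expR (- primitive theta M))%:E)%E.
Proof.
move=> th_cont th_supp M0 th0 thB.
pose A w := occupation (phi \o theta) w.
have k_uc := kappa_uc th_cont th_supp th0.
have mk := measurable_uc k_uc.
have mA : measurable_fun setT A.
  by apply: (measurable_occupation mk) => y _; exact: phi_ge0.
have mdA : measurable_fun setT (fun w => damp (A w)).
  exact: measurableT_comp (@measurable_damp R) mA.
(* [regulated_mean_compact] asks for a positive time, hence [n.+1]. *)
pose g (n : nat) w := expR (regulated_exponent X phi theta n.+1%:R w).
pose G w := expR (primitive theta M) * damp (A w).
have mG : measurable_fun setT G by exact: measurable_funM.
have cg : {ae P, forall w, g n w @[n --> \oo] --> G w}.
  have := regulator_unbounded M0.
  apply: filterS => w [n0 Mn0].
  apply: cvg_near_cst; exists n0 => // n /= n0n; rewrite /g /G.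
  have Lbig s : n0%:R <= s -> M < L w s.
    move=> ns; apply: (lt_le_trans Mn0); apply: regulator_le => //.
  have nn : n0%:R <= n.+1%:R :> R by rewrite ler_nat ltnW.
  have -> : A w = (primitive (phi \o theta \o L w) n.+1%:R)%:E.
    apply: (@integral_half_line_primitive _ _ (phi B)).
    - apply: measurableT_comp => //; exact: (measurable_regulator (path_cadlag w) (@path_jumps w) (path0 w)).
    - by move=> y /=; rewrite ger0_norm ?phi_ge0// phi_le.
    - move=> y ny /=; rewrite th_supp//.
      rewrite ltW// (lt_le_trans (Lbig y _)) ?ler_norm//.
      by rewrite (le_trans nn)// ltW.
  rewrite damp_fin -expRD /regulated_exponent.
  have Ln := Lbig n.+1%:R nn.
  rewrite th_supp; last by rewrite ltW// (lt_le_trans Ln)// ler_norm.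
  rewrite (primitive_stationary th_cont th_supp M0 th0 thB (ltW Ln)).
  by congr expR; ring.
have := @bounded_cvg_integral _ _ _ P g G (expR (B * M)) _ mG _ cg.
have mg n : measurable_fun setT (g n).
  by apply: (measurable_regulated_compact th_cont th_supp th0 thB).
move=> /(_ mg) cI.
have gb n w : `|g n w| <= expR (B * M).
  rewrite ger0_norm ?expR_ge0// ler_expR.
  have n1 : 0 <= n.+1%:R :> R by [].
  have := regulated_exponent_le phi hX th0 w n1.
  have := clock_ge0 X phi_ge0 th0 n.+1%:R w.
  have Ln := regulator_ge0 (path_cadlag w) (@path_jumps w) (path0 w) n1.
  have := primitive_bounded th_cont th_supp M0 th0 thB Ln; lra.
have {}cI := cI gb.
have : (\int[P]_w (G w)%:E = 1)%E.
  rewrite -(cvg_lim _ cI)//; apply: lim_near_cst => //; apply: nearW => n.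
  by apply: (regulated_mean_compact th_cont th_supp M0 th0 thB).
under eq_integral do rewrite EFinM.
rewrite ge0_integralZl_EFin ?expR_ge0//; last 2 first.
- by move=> w _; rewrite lee_fin damp_ge0.
- exact/measurable_EFinP.
move=> h; rewrite -[LHS]mul1e -[in LHS](expR0 R) -(addNr (primitive theta M)) expRD EFinM.
by rewrite -muleA h mule1.
Qed.

Definition mean_damp (kappa : R -> R) : R :=
  fine (\int[P]_w (damp (occupation kappa w))%:E).

Section nonnegative_rates.
Context (kappa : R -> R).
Hypothesis mk : measurable_fun setT kappa.
Hypothesis k0 : forall y, 0 <= kappa y.

Lemma measurable_kappa_path w : measurable_fun setT (fun s => (kappa (L w s))%:E).
Proof.
apply/measurable_EFinP; apply: measurableT_comp => //.
exact: (measurable_regulator (path_cadlag w) (@path_jumps w) (path0 w)).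
Qed.

Lemma measurable_damp_occupation : measurable_fun setT (fun w => damp (occupation kappa w)).
Proof.
have mo : measurable_fun setT (occupation kappa) by apply: (measurable_occupation mk).
exact: measurableT_comp (@measurable_damp R) mo.
Qed.

Lemma damp_occupation_bounds w : 0 <= damp (occupation kappa w) <= 1.
Proof. by rewrite damp_ge0 damp_le1// occupation_ge0. Qed.

Lemma mean_dampE : (\int[P]_w (damp (occupation kappa w))%:E)%E = (mean_damp kappa)%:E.
Proof.
have /andP[lo hi] :=
  integral_le1_bounded P measurable_damp_occupation damp_occupation_bounds.
by rewrite /mean_damp fineK// fin_numElt (lt_le_trans (ltNyr _) lo)/= (le_lt_trans hi (ltry _)).
Qed.

End nonnegative_rates.

Lemma measurable_exponent_comp (u : R -> R) : measurable_fun setT u ->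
  (forall y, 0 <= u y) -> measurable_fun setT (phi \o u).
Proof.
move=> mu u0; rewrite (_ : phi \o u = (phi \o Num.max 0) \o u).
  by apply: measurableT_comp => //; exact: continuous_measurable_fun.
by apply/funext => y /=; rewrite (max_idPr (u0 y)).
Qed.

Lemma mean_damp_cvg (k_ : nat -> R -> R) (k : R -> R) :
  (forall n, measurable_fun setT (k_ n)) -> measurable_fun setT k ->
  (forall n y, 0 <= k_ n y) -> (forall y, 0 <= k y) ->
  (forall m n y, (m <= n)%N -> k_ m y <= k_ n y) ->
  (forall y, k_ n y @[n --> \oo] --> k y) ->
  mean_damp (k_ n) @[n --> \oo] --> mean_damp k.
Proof.
move=> mk_ mk k_0 k0 nd ck.
have co w : occupation (k_ n) w @[n --> \oo] --> occupation k w.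
  have := @cvg_monotone_convergence _ _ _ leb `[0%R, +oo[%classic _
    (fun n s => (k_ n (L w s))%:E).
  move=> /(_ _ _ _ _).
  rewrite (_ : (\int[leb]_(s in _) _)%E = occupation k w); last first.
    apply: eq_integral => s _; apply/cvg_lim => //.
    by apply/fine_cvgP; split; [exact: nearW|exact: ck].
  apply => //.
  - by move=> n; apply: measurable_funTS; exact: measurable_kappa_path.
  - by move=> n s _; rewrite lee_fin.
  - by move=> s _ m n mn; rewrite lee_fin nd.
have := @bounded_cvg_integral _ _ _ P (fun n w => damp (occupation (k_ n) w))
  (fun w => damp (occupation k w)) 1.
move=> /(_ (fun n => measurable_damp_occupation (mk_ n) (k_0 n)))
       /(_ (measurable_damp_occupation mk k0)).
have h1 n w : `|damp (occupation (k_ n) w)| <= 1.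
  by have /andP[h0 h1] := damp_occupation_bounds (k_0 n) w; rewrite ger0_norm.
move=> /(_ h1); rewrite mean_dampE//.
have h2 : {ae P, forall w, damp (occupation (k_ n) w) @[n --> \oo] --> damp (occupation k w)}.
  apply: aeW => w; apply: damp_cvg => // n; exact: occupation_ge0.
move=> /(_ h2) /fine_cvgP[_].
by apply: cvg_trans; apply: near_eq_cvg; apply: nearW => n /=; rewrite mean_dampE.
Qed.

Lemma primitive_close (u v : R -> R) (B M eps : R) (U : set R) :
  measurable_fun setT u -> measurable_fun setT v -> measurable U ->
  (forall y, 0 <= u y <= B) -> (forall y, 0 <= v y <= B) ->
  (leb U <= eps%:E)%E -> (forall y, ~ U y -> u y = v y) ->
  primitive u M <= primitive v M + B * eps.
Proof.
move=> mu mv mU uB vB lU uv.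
have B0 : 0 <= B by have /andP[? ?] := uB 0; exact: le_trans (_ : 0 <= u 0) _.
have ub y : `|u y| <= B by have /andP[? ?] := uB y; rewrite ger0_norm.
have vb y : `|v y| <= B by have /andP[? ?] := vB y; rewrite ger0_norm.
have iu := bounded_itv_integrable mu ub true false 0 M.
have iv := bounded_itv_integrable mv vb true false 0 M.
have fu : (\int[leb]_(y in `[0%R, M]) (u y)%:E \is a fin_num)%E by exact: integrable_fin_num.
have fv : (\int[leb]_(y in `[0%R, M]) (v y)%:E \is a fin_num)%E by exact: integrable_fin_num.
rewrite -lee_fin EFinD /primitive /Rintegral !fineK//.
apply: (@le_trans _ _ (\int[leb]_(y in `[0%R, M]) ((v y)%:E + (B * \1_U y)%:E))%E).
  apply: ge0_le_integral => //.
  - by move=> y _; rewrite lee_fin; case/andP: (uB y).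
  - by apply/measurable_EFinP; exact: measurable_funTS.
  - apply: emeasurable_funD; apply/measurable_EFinP; apply: measurable_funTS => //.
    by apply: measurable_funM => //; exact: measurable_indic.
  move=> y _; rewrite -EFinD lee_fin indicE.
  have [yU|yU] := boolP (y \in U).
    by rewrite mulr1; have /andP[? ?] := uB y; have /andP[? ?] := vB y; lra.
  by rewrite uv ?mulr0 ?addr0//; move: yU; rewrite notin_setE.
rewrite ge0_integralD//; last 4 first.
- by move=> y _; rewrite lee_fin; case/andP: (vB y).
- by apply/measurable_EFinP; exact: measurable_funTS.
- by move=> y _; rewrite lee_fin mulr_ge0.
- by apply/measurable_EFinP; apply: measurable_funTS; apply: measurable_funM => //; exact: measurable_indic.
apply: leeD => //; under eq_integral do rewrite EFinM.
rewrite ge0_integralZl_EFin//; last first.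
  by apply/measurable_EFinP; apply: measurable_funTS; exact: measurable_indic.
rewrite integral_indic// EFinM; apply: lee_wpmul2l; first by rewrite lee_fin.
apply: le_trans lU; apply: le_measure; rewrite ?inE//; exact: measurableI.
Qed.

(** The functions [min B (k * dist_to (~` U))] are continuous and increase with
    [k] to [B * \1_U]. *)
Lemma mean_damp_open (U : set R) (B M eps : R) : open U ->
  (forall y, U y -> `|y| < M) -> (leb U <= eps%:E)%E -> 0 <= M -> 0 <= B ->
  expR (- (B * eps)) <= mean_damp (fun y => phi (B * \1_U y)).
Proof.
move=> oU UM lU M0 B0.
have neU : ~` U !=set0.
  by exists M => /UM; rewrite ger0_norm// ltxx.
have mU : measurable U by exact: open_measurable.
pose th (k : nat) y := Num.min B (k%:R * dist_to (~` U) y).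
have th_cont k : continuous (th k).
  move=> y; apply: (@continuous_min _ _ (cst B) (fun z => k%:R * dist_to (~` U) z)).
    exact: cvg_cst.
  by apply: cvgMr; exact: dist_to_continuous.
have th_out k y : ~ U y -> th k y = 0.
  by move=> nU; rewrite /th dist_to_eq0// mulr0; exact/min_idPr.
have th_supp k y : M <= `|y| -> th k y = 0.
  by move=> My; apply: th_out => /UM; rewrite ltNge My.
have th0 k y : 0 <= th k y by rewrite le_min B0 mulr_ge0// dist_to_ge0.
have thB k y : th k y <= B by rewrite ge_min lexx.
have B1 y : 0 <= B * \1_U y by rewrite mulr_ge0.
have mB1 : measurable_fun setT (fun y => B * \1_U y : R).
  by apply: measurable_funM => //; exact: measurable_indic.
have cvg_md : mean_damp (phi \o th k) @[k --> \oo] --> mean_damp (fun y => phi (B * \1_U y)).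
  apply: mean_damp_cvg.
  - move=> k; apply: measurable_exponent_comp => //.
    by apply: continuous_measurable_fun; exact: th_cont.
  - exact: measurable_exponent_comp mB1 B1.
  - by move=> k y; exact: phi_ge0.
  - by move=> y; exact: phi_ge0.
  - move=> m n y mn /=; apply: phi_le => //; rewrite /th le_min ge_min lexx/=.
    by rewrite ge_min; apply/orP; right; rewrite ler_wpM2r ?dist_to_ge0// ler_nat.
  - move=> y; have [Uy|nUy] := pselect (U y); last first.
      rewrite indicE memNset// mulr0; apply: cvg_near_cst; apply: nearW => k /=.
      by rewrite th_out.
    rewrite indicE mem_set// mulr1.
    have dy : 0 < dist_to (~` U) y by apply: dist_to_gt0; rewrite ?setCK//; apply.
    apply: cvg_near_cst; exists (Num.truncn (B / dist_to (~` U) y)).+1 => // k /= kB.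
    congr phi; apply/min_idPl; rewrite -ler_pdivrMr//.
    by rewrite (le_trans (ltW (truncnS_gt _)))// ler_nat.
rewrite -(cvg_lim (@Rhausdorff R) cvg_md); apply: limr_ge.
  by apply/cvg_ex; eexists; exact: cvg_md.
apply: nearW => k.
have := laplace_functional_compact (th_cont k) (th_supp k) M0 (th0 k) (thB k).
have mth : measurable_fun setT (th k) by apply: continuous_measurable_fun; exact: th_cont.
rewrite mean_dampE; last 2 first.
- exact: measurable_exponent_comp.
- by move=> y; exact: phi_ge0.
move=> [->]; rewrite ler_expR lerN2.
have := @primitive_close (th k) (cst 0) B M eps U mth (measurable_cst _) mU _ _ lU _.
rewrite (_ : primitive (cst 0) M = 0) ?add0r; last first.
  by rewrite /primitive Rintegral_cst//= mul0r.
apply.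
- by move=> y; rewrite th0 thB.
- by move=> y; rewrite lexx B0.
- by move=> y /th_out ->.
Qed.

(** [phi \o u <= phi \o v + phi (B * \1_U)], so that [damp] of the left
    occupation is at least a product [a * b] of two numbers in [[0, 1]], and
    [a * b >= a + b - 1]; the mean of [b] is bounded by [mean_damp_open]. *)
Lemma mean_damp_close (u v : R -> R) (B M eps : R) (U : set R) :
  measurable_fun setT u -> measurable_fun setT v -> open U ->
  (forall y, U y -> `|y| < M) -> 0 <= M ->
  (forall y, 0 <= u y <= B) -> (forall y, 0 <= v y <= B) ->
  (leb U <= eps%:E)%E -> (forall y, ~ U y -> u y = v y) ->
  mean_damp (phi \o v) <= mean_damp (phi \o u) + B * eps.
Proof.
move=> mu mv oU UM M0 uB vB lU uv.
have mU : measurable U by exact: open_measurable.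
have B0 : 0 <= B by have /andP[? ?] := uB 0; exact: le_trans (_ : 0 <= u 0) _.
have u0 y : 0 <= u y by have /andP[] := uB y.
have v0 y : 0 <= v y by have /andP[] := vB y.
have B1 y : 0 <= B * \1_U y by rewrite mulr_ge0.
have mB1 : measurable_fun setT (fun y => B * \1_U y : R).
  by apply: measurable_funM => //; exact: measurable_indic.
pose kU y := phi (B * \1_U y).
have mkU : measurable_fun setT kU := measurable_exponent_comp mB1 B1.
have mku := measurable_exponent_comp mu u0.
have mkv := measurable_exponent_comp mv v0.
have kU0 y : 0 <= kU y by exact: phi_ge0.
have ku0 y : 0 <= (phi \o u) y by exact: phi_ge0.
have kv0 y : 0 <= (phi \o v) y by exact: phi_ge0.
have hU := mean_damp_open oU UM lU M0 B0.
suff : mean_damp (phi \o v) + mean_damp kU <= mean_damp (phi \o u) + 1.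
  move: hU (expR_ge1Dx (- (B * eps))); rewrite -/kU.
  move: (B * eps) (mean_damp _) (mean_damp _) (mean_damp _) (expR _) => *; lra.
rewrite -lee_fin !EFinD -(mean_dampE mkv kv0) -(mean_dampE mkU kU0) -(mean_dampE mku ku0).
rewrite -ge0_integralD//; last 4 first.
- by move=> w _; rewrite lee_fin damp_ge0.
- by apply/measurable_EFinP; exact: measurable_damp_occupation.
- by move=> w _; rewrite lee_fin damp_ge0.
- by apply/measurable_EFinP; exact: measurable_damp_occupation.
rewrite (_ : 1%E = \int[P]_w 1)%E; last by rewrite integral_cst//= probability_setT mule1.
rewrite -ge0_integralD//; last 2 first.
- by move=> w _; rewrite lee_fin damp_ge0.
- by apply/measurable_EFinP; exact: measurable_damp_occupation.
apply: ge0_le_integral => //.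
- by move=> w _; rewrite -EFinD lee_fin addr_ge0 ?damp_ge0.
- by apply: emeasurable_funD; apply/measurable_EFinP; exact: measurable_damp_occupation.
- by apply: emeasurable_funD => //; apply/measurable_EFinP; exact: measurable_damp_occupation.
move=> w _; rewrite -!EFinD lee_fin.
have ov0 : (0 <= occupation (phi \o v) w)%E by apply: occupation_ge0.
have oU0 : (0 <= occupation kU w)%E by apply: occupation_ge0.
have ou0 : (0 <= occupation (phi \o u) w)%E by apply: occupation_ge0.
have le_occ : (occupation (phi \o u) w <= occupation (phi \o v) w + occupation kU w)%E.
  rewrite /occupation -ge0_integralD//; last 4 first.
  - by move=> s _; rewrite lee_fin kv0.
  - by apply: measurable_funTS; exact: measurable_kappa_path.
  - by move=> s _; rewrite lee_fin kU0.
  - by apply: measurable_funTS; exact: measurable_kappa_path.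
  apply: ge0_le_integral => //.
  - by move=> s _; rewrite lee_fin ku0.
  - by apply: measurable_funTS; exact: measurable_kappa_path.
  - by apply: emeasurable_funD; apply: measurable_funTS; exact: measurable_kappa_path.
  move=> s _; rewrite -EFinD lee_fin /= /kU indicE.
  have [yU|yU] := boolP (L w s \in U).
    have /andP[? ?] := uB (L w s).
    rewrite mulr1; have := kv0 (L w s); have := phi_le (u0 (L w s)) (_ : _ <= B).
    by move=> /(_ ltac:(by [])) /=; lra.
  by rewrite mulr0 phi0 addr0 uv//; move: yU; rewrite notin_setE.
have := damp_le ou0 le_occ; rewrite dampD//.
have /andP[v_0 v_1] := damp_occupation_bounds kv0 w.
have /andP[U_0 U_1] := damp_occupation_bounds kU0 w.
have : 0 <= (1 - damp (occupation (phi \o v) w)) * (1 - damp (occupation kU w)).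
  by rewrite mulr_ge0// subr_ge0.
lra.
Qed.

Lemma mean_damp_bounded (u : R -> R) (B M : R) : measurable_fun setT u ->
  (forall y, 0 <= u y <= B) -> 0 <= M -> (forall y, ~ (0 <= y <= M) -> u y = 0) ->
  mean_damp (phi \o u) = expR (- primitive u (M + 1)).
Proof.
move=> mu uB' M0 u0.
(* Tietze's theorem asks for a positive bound. *)
wlog B0 : B uB' / 0 < B.
  move=> h; apply: (h (B + 1)).
    by move=> y; have /andP[y0 yB] := uB' y; rewrite y0/=; lra.
  by have /andP[y0 yB] := uB' 0; lra.
have M1 : 0 <= M + 1 by lra.
have prim_ge0 v : (forall y, 0 <= v y) -> 0 <= primitive v (M + 1).
  by move=> v0; apply: Rintegral_ge0.
have uge0 y : 0 <= u y by have /andP[] := uB' y.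
have step eps : 0 < eps ->
    `|mean_damp (phi \o u) - expR (- primitive u (M + 1))| <= 2 * B * eps.
  move=> eps0.
  have [g [U [cg gB gM [oU UM lU ug]]]] :=
    bounded_continuous_approximation mu uB' B0 M0 u0 eps0.
  have gge0 y : 0 <= g y by have /andP[] := gB y.
  have gleB y : g y <= B by have /andP[] := gB y.
  have mg : measurable_fun setT g by exact: continuous_measurable_fun.
  have mU : measurable U by exact: open_measurable.
  have gu y : ~ U y -> g y = u y by move=> /ug.
  have h1 := mean_damp_close mu mg oU UM M1 uB' gB lU ug.
  have h2 := mean_damp_close mg mu oU UM M1 gB uB' lU gu.
  have h3 := primitive_close (M + 1) mu mg mU uB' gB lU ug.
  have h4 := primitive_close (M + 1) mg mu mU gB uB' lU gu.
  have h5 : mean_damp (phi \o g) = expR (- primitive g (M + 1)).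
    by rewrite /mean_damp
      (laplace_functional_compact cg gM M1 gge0 gleB).
  have pu := prim_ge0 u uge0; have pg := prim_ge0 g gge0.
  have h6 := expRN_lipschitz pu pg.
  have h7 := expRN_lipschitz pg pu.
  have h8 : `|primitive u (M + 1) - primitive g (M + 1)| <= B * eps.
    rewrite ler_norml; apply/andP; split; last by rewrite lerBlDl; exact: h3.
    by rewrite lerNl opprB lerBlDl; exact: h4.
  rewrite distrC in h7; move: h1 h2 (le_trans h6 h8) (le_trans h7 h8); rewrite h5.
  rewrite ler_norml (_ : 2 * B * eps = B * eps + B * eps); last by ring.
  move: (B * eps) (mean_damp _) (expR _) (expR _) => *.
  by apply/andP; split; lra.
apply/eqP; rewrite -subr_eq0 -normr_le0 leNgt; apply/negP => h.
set m := `|_| in step h.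
have e0 : 0 < m / (4 * B) by rewrite divr_gt0// mulr_gt0.
have := step _ e0.
rewrite (_ : 2 * B * (m / (4 * B)) = m / 2); last by field; rewrite gt_eqF.
lra.
Qed.

(** Monotone convergence along the truncations [min u n] on both sides; either
    side may vanish in the limit. *)
Lemma laplace_functional (u : R -> R) (M : R) : measurable_fun setT u ->
  (forall y, 0 <= u y) -> 0 <= M -> (forall y, ~ (0 <= y <= M) -> u y = 0) ->
  (\int[P]_w expeR (- \int[leb]_(s in `[0%R, +oo[) (phi (u (L w s)))%:E) =
   expeR (- \int[leb]_(y in `[0%R, +oo[) (u y)%:E))%E.
Proof.
move=> mu u0 M0 uM.
have mk := measurable_exponent_comp mu u0.
have k0 y : 0 <= (phi \o u) y by exact: phi_ge0.
have -> : (\int[P]_w expeR (- \int[leb]_(s in `[0%R, +oo[) (phi (u (L w s)))%:E) =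
           (mean_damp (phi \o u))%:E)%E.
  rewrite -mean_dampE//; apply: eq_integral => w _.
  by rewrite dampE// occupation_ge0.
have I0 : (0 <= \int[leb]_(y in `[0%R, +oo[) (u y)%:E)%E.
  by apply: integral_ge0 => y _; rewrite lee_fin.
rewrite -dampE//; congr (_)%:E.
pose un (n : nat) y := Num.min (u y) n%:R.
have un0 n y : 0 <= un n y by rewrite le_min u0/=.
have mun n : measurable_fun setT (un n) by exact: measurable_minr.
have unM n y : ~ (0 <= y <= M) -> un n y = 0.
  by move=> /uM; rewrite /un => ->; apply/min_idPl.
have und m n y : (m <= n)%N -> un m y <= un n y.
  move=> mn; rewrite /un le_min ge_min lexx/= ge_min ler_nat mn orbT//.
have unu y : \forall n \near \oo, un n y = u y.
  exists (Num.truncn (u y)).+1 => // n /= hn; apply/min_idPl.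
  by rewrite (le_trans (ltW (truncnS_gt _)))// ler_nat.
have c1 : mean_damp (phi \o un n) @[n --> \oo] --> mean_damp (phi \o u).
  apply: mean_damp_cvg => //.
  - by move=> n; exact: measurable_exponent_comp.
  - by move=> n y; exact: phi_ge0.
  - by move=> m n y mn /=; apply: phi_le => //; exact: und.
  - move=> y; apply: cvg_near_cst; apply: filterS (unu y) => n /=.
    by move=> ->.
have c2 : mean_damp (phi \o un n) @[n --> \oo] -->
    damp (\int[leb]_(y in `[0%R, +oo[) (u y)%:E).
  rewrite (_ : (fun n => mean_damp _) =
     (fun n => damp (\int[leb]_(y in `[0%R, +oo[) (un n y)%:E))); last first.
    apply/funext => n.
    have unn y : 0 <= un n y <= n%:R by rewrite un0/= ge_min lexx orbT.
    rewrite (mean_damp_bounded (mun n) unn M0 (unM n)).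
    have ub y : `|un n y| <= n%:R by rewrite ger0_norm// ge_min lexx orbT.
    have uz y : M + 1 < y -> un n y = 0 by move=> yM; apply: unM => /andP[_]; lra.
    by rewrite (integral_half_line_primitive (mun n) ub uz).
  apply: damp_cvg.
    by move=> n; apply: integral_ge0 => y _; rewrite lee_fin.
  have := @cvg_monotone_convergence _ _ _ leb `[0%R, +oo[%classic _
    (fun n y => (un n y)%:E).
  move=> /(_ _ _ _ _).
  rewrite (_ : (\int[leb]_(y in _) limn _)%E = (\int[leb]_(y in `[0%R, +oo[) (u y)%:E)%E); last first.
    apply: eq_integral => y _; apply/cvg_lim => //; apply: cvg_near_cst.
    by apply: filterS (unu y) => n /= ->.
  apply => //.
  - by move=> n; apply/measurable_EFinP; apply: measurable_funTS; exact: mun.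
  - by move=> n y _; rewrite lee_fin.
  - by move=> y _ m n mn; rewrite lee_fin und.
exact: (cvg_unique (@Rhausdorff R) c1 c2).
Qed.

End laplace_functional.

(** * The area as an additive functional of the regulator *)

Section hitting_times.
Context (R : realType) (f : R -> R).
Hypothesis f_cadlag : cadlag f.
Hypothesis f_jumps : no_negative_jumps f.
Hypothesis f0 : f 0 = 0.
Local Notation L := (regulator f).

Lemma hitting_time_le (x y : R) : x <= y -> (hitting_time f x <= hitting_time f y)%E.
Proof.
move=> xy; apply: ereal_inf_le_tmp => _ [t [t0 ft] <-]; exists t => //.
by split => //; apply: (lt_le_trans ft); rewrite lerN2.
Qed.

Lemma lt_hitting_time (x t : R) : 0 <= t -> (t%:E < hitting_time f x)%E -> L t <= x.
Proof.
move=> t0 tT; apply: regulator_least => // s s0 st.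
rewrite leNgt; apply/negP => fs.
have : (hitting_time f x <= s%:E)%E.
  by apply: ereal_inf_lbound; exists s => //; split => //; rewrite ltrNr.
move=> /(lt_le_trans tT); rewrite lte_fin; lra.
Qed.

Lemma hitting_time_ge (x t : R) : 0 <= t -> L t <= x -> (t%:E <= hitting_time f x)%E.
Proof.
move=> t0 Lx; apply: le_ereal_inf_tmp => _ [s [s0 fs] <-].
rewrite lee_fin leNgt; apply/negP => st.
have := regulator_ubound f_cadlag f_jumps f0 s0 (ltW st); lra.
Qed.

(** At the instant [T_x] itself [L = x] may hold, so the two sets can differ by
    that one point. *)
Lemma before_hitting_time (x : R) :
  [set t : R | (0 <= t%:E < hitting_time f x)%E] =
  [set t | 0 <= t /\ L t <= x] `\` [set t : R | t%:E = hitting_time f x].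
Proof.
apply/seteqP; split=> t /=.
  move=> /andP[t0 tT]; rewrite lee_fin in t0; split; last by move=> tE; rewrite tE ltxx in tT.
  by split => //; exact: lt_hitting_time.
move=> [[t0 Lx] /eqP tT]; rewrite lee_fin t0/= lt_neqAle tT/=.
exact: hitting_time_ge.
Qed.

Lemma secondary_jumpE (x t : R) : 0 <= x -> 0 <= t ->
  (t%:E < hitting_time f x)%E -> secondary_jump f x t = f t + x.
Proof.
move=> x0 t0 tT; rewrite /secondary_jump.
suff -> : limn (fun N => (\sum_(1 <= n < N)
    n%:R * \1_(`[jump_epoch f x n.-1, jump_epoch f x n[ : set (\bar R)) t%:E)%R : R) = 1.
  by rewrite mulr1.
(* Only the term [n = 1] of the series survives before the first epoch. *)
apply: lim_near_cst; first exact: Rhausdorff.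
exists 2%N => // N /= N2; rewrite big_ltn//.
rewrite big_nat_cond big1 ?addr0 => [|n /andP[/andP[n2 _] _]].
  rewrite indicE mem_set ?mulr1//= in_itv/= lee_fin t0/=.
  by rewrite mul1r.
rewrite indicE memNset ?mulr0//= in_itv/= => /andP[+ _]; apply/negP; rewrite -ltNge.
apply: (lt_le_trans tT); case: n n2 => [//|[//|n]] _ /=.
by apply: hitting_time_le; rewrite ler_peMl// ler1n.
Qed.

End hitting_times.

Section reflection.
Context (R : realType).
Local Notation leb := (@lebesgue_measure R).

Lemma integral_reflect (x : R) (v : R -> R) : measurable_fun setT v ->
  (forall y, 0 <= v y) ->
  (\int[leb]_(y in `[0%R, x]) (v (x - y))%:E = \int[leb]_(y in `[0%R, x]) (v y)%:E)%E.
Proof.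
move=> mv v0; pose r (y : measurableTypeR R) : measurableTypeR R := x - y.
have mr : measurable_fun setT r by apply: measurable_funB.
pose pr : {mfun measurableTypeR R >-> measurableTypeR R} :=
  HB.pack r (isMeasurableFun.Build _ _ _ _ _ mr).
have hr A : measurable A -> pushforward leb pr A = leb A.
  move=> mA; apply/esym/lebesgue_measure_unique => //= _ [[a b]] _ <-.
  rewrite /pushforward (_ : _ @^-1` _ = `[x - b, x - a[%classic).
    rewrite /= !lebesgue_measure_itv/= !lte_fin.
    rewrite (_ : (x - b < x - a) = (a < b)); last by apply/idP/idP; lra.
    by case: ifP => // _; rewrite -!EFinD; congr _%:E; ring.
  by apply/seteqP; split=> y /=; rewrite !in_itv/= /r => /andP[? ?]; apply/andP; split; lra.
have : (\int[pushforward leb pr]_(y in `[0%R, x]) (v y)%:E =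
        \int[leb]_(y in `[0%R, x]) (v y)%:E)%E.
  by apply: eq_measure_integral => A mA _; exact: hr.
rewrite ge0_integral_pushforward//=.
- rewrite (_ : r @^-1` _ = `[0, x]%classic)//.
  by apply/seteqP; split=> y /=; rewrite !in_itv/= /r => /andP[? ?]; apply/andP; split; lra.
- by apply/measurable_EFinP; apply: measurable_funTS.
- by move=> y _; rewrite lee_fin.
Qed.

End reflection.

Section area_as_occupation.
Context (R : realType) (f h : R -> R) (x alpha : R).
Hypothesis f_cadlag : cadlag f.
Hypothesis f_jumps : no_negative_jumps f.
Hypothesis f0 : f 0 = 0.
Hypothesis h_meas : measurable_fun (`[0, +oo[ : set R) h.
Hypothesis h_ge0 : forall y : R, 0 <= y -> 0 <= h y.
Hypothesis x_ge0 : 0 <= x.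
Hypothesis alpha_ge0 : 0 <= alpha.
Local Notation leb := (@lebesgue_measure R).
Local Notation L := (regulator f).

Lemma measurable_half_line_extension : measurable_fun setT (h \o Num.max 0).
Proof.
have mm : measurable_fun setT (Num.max 0 : R -> R).
  by apply: measurable_maxr => //; exact: measurable_cst.
have im : Num.max 0 @` setT `<=` (`[0, +oo[ : set R).
  by move=> _ [y _ <-] /=; rewrite in_itv/= andbT le_max lexx.
exact: (measurable_comp _ im h_meas mm).
Qed.

Lemma area_occupation : (alpha%:E * area h f x =
  \int[leb]_(s in `[0%R, +oo[) (if (L s <= x)%R then alpha * h (x - L s) else 0)%:E)%E.
Proof.
pose E := [set t : R | 0 <= t /\ L t <= x].
pose N := [set t : R | t%:E = hitting_time f x].
pose g t := (h \o Num.max 0) (x - L t).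
have mL : measurable_fun setT L := measurable_regulator f_cadlag f_jumps f0.
have mE : measurable E.
  rewrite (_ : E = `[0, +oo[%classic `&` (L @^-1` `]-oo, x])).
    by apply: measurableI => //; rewrite -[X in measurable X]setTI; exact: mL.
  by apply/seteqP; split=> t /=; rewrite !in_itv/= andbT.
have [mN N0] : measurable N /\ leb N = 0%E.
  rewrite /N; case: (hitting_time f x) => [r| |].
  - rewrite (_ : [set t | _] = [set r]); last first.
      by apply/seteqP; split=> t /= => [[]|->].
    by split; [exact: measurable_set1|exact: lebesgue_measure_set1].
  - rewrite (_ : [set t | _] = set0); first by rewrite measure0.
    by apply/seteqP; split.
  - rewrite (_ : [set t | _] = set0); first by rewrite measure0.
    by apply/seteqP; split.
have mg : measurable_fun setT g.
  by apply: (measurableT_comp measurable_half_line_extension); exact: measurable_funB.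
have g0 t : 0 <= g t by apply: h_ge0; rewrite le_max lexx.
have -> : area h f x = (\int[leb]_(t in E `\` N) (g t)%:E)%E.
  rewrite /area (before_hitting_time f_cadlag f_jumps f0 x); apply: eq_integral => t.
  rewrite -(before_hitting_time f_cadlag f_jumps f0 x) inE/= lee_fin => /andP[t0 tT].
  rewrite (secondary_jumpE x_ge0 t0 tT) /g /reflected /=; congr (h _)%:E.
  rewrite (_ : f t + x - (f t + L t) = x - L t); last by ring.
  by apply/esym/max_idPr; rewrite subr_ge0 (lt_hitting_time t0 tT).
rewrite -ge0_negligible_integral//; last 2 first.
- by apply/measurable_EFinP; exact: measurable_funTS.
- by move=> t _; rewrite lee_fin.
rewrite -ge0_integralZl_EFin//; last 2 first.
- by move=> t _; rewrite lee_fin.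
- by apply/measurable_EFinP; exact: measurable_funTS.
rewrite [LHS]integral_mkcond [RHS]integral_mkcond; apply: eq_integral => t _.
rewrite /= !patchE mem_setE in_itv/= andbT.
have [tE|tE] := boolP (t \in E).
  have [t0 Lx] := set_mem tE; rewrite t0 Lx -EFinM /g /=.
  by rewrite (max_idPr _)// subr_ge0.
case: (leP 0 t) => // t0; case: (leP (L t) x) => // Lx.
by exfalso; move: tE; rewrite notin_setE; apply.
Qed.

End area_as_occupation.

Theorem theorem1 (d : measure_display) (Omega : measurableType d)
  (R : realType) (P : probability Omega R)
  (X : R -> {RV P >-> R}) (phi : R -> R) (dphi0 : R) (h : R -> R) (x : R)
  (hX : spectrally_positive_levy X)
  (hphi : laplace_exponent X phi)
  (hdphi0 : (phi^`())%classic a @[a --> 0^'+] --> dphi0)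
  (dphi0_gt0 : 0 < dphi0)
  (h_meas : measurable_fun (`[0, +oo[ : set R) h)
  (h_ge0 : forall y : R, 0 <= y -> 0 <= h y)
  (x_gt0 : 0 < x) (alpha : R) (alpha_ge0 : 0 <= alpha) :
  (\int[P]_w expeR (- (alpha%:E * area h (fun t => X t w) x))
   = expeR (- \int[lebesgue_measure]_(y in `[0%R, x])
                 (exponent_inv phi (alpha * h y))%:E))%E.
Proof.
have hphi1 a : 0 <= a -> (\int[P]_w (expR (- a * X 1 w))%:E = (expR (phi a))%:E)%E.
  by move=> a0; have := hphi a 1 a0 ler01; rewrite unlock mulr1.
have mX1 : measurable_fun setT (X 1) by [].
have phi0 : phi 0 = 0 := exponent_eq0 hphi1.
have phi_cvx := exponent_convex mX1 hphi1.
have [c c0 phi_growth] := exponent_growth mX1 hphi1 hdphi0 dphi0_gt0.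
have phi_le := exponent_le c0 phi_growth.
have phi_gt0 a : 0 < a -> 0 < phi a.
  move=> a0; have := phi_growth 0 a (lexx 0) (ltW a0).
  by rewrite phi0 !subr0; apply: lt_le_trans; rewrite mulr_gt0.
have phi_cont := exponent_continuous phi0 phi_cvx c0 phi_growth.
have inv_spec := exponent_inv_spec phi0 phi_cvx c0 phi_growth.
have ah0 y : 0 <= alpha * (h \o Num.max 0) y.
  by rewrite mulr_ge0//= h_ge0// le_max lexx.
(* [theta] is [u] below; extending [h] by its value at 0 makes it measurable on
   the whole line. *)
pose v y := exponent_inv phi (Num.max 0 (alpha * (h \o Num.max 0) y)).
have vE y : 0 <= y -> v y = exponent_inv phi (alpha * h y).
  by move=> y0; rewrite /v (max_idPr (ah0 y)) /= (max_idPr y0).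
have mv : measurable_fun setT v.
  apply: (measurableT_comp (measurable_exponent_inv phi0 phi_cvx c0 phi_growth)).
  by apply: measurable_funM => //; exact: measurable_half_line_extension.
have v0 y : 0 <= v y.
  have q0 : 0 <= Num.max 0 (alpha * (h \o Num.max 0) y) by rewrite le_max lexx.
  by have [] := inv_spec _ q0.
pose u y := v (x - y) * \1_(`[0, x]%classic : set R) y.
have mu : measurable_fun setT u.
  apply: measurable_funM; last exact: measurable_indic.
  by apply: (measurableT_comp mv); exact: measurable_funB.
have u0 y : 0 <= u y by rewrite mulr_ge0.
have uout y : ~ (0 <= y <= x) -> u y = 0.
  by move=> yx; rewrite /u indicE memNset ?mulr0//= in_itv.
have := laplace_functional hX hphi phi0 phi_le phi_gt0 phi_cont mu u0 (ltW x_gt0) uout.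
have -> : (\int[lebesgue_measure]_(y in `[0%R, +oo[) (u y)%:E =
  \int[lebesgue_measure]_(y in `[0%R, x]) (exponent_inv phi (alpha * h y))%:E)%E.
  rewrite [RHS](_ : _ = \int[lebesgue_measure]_(y in `[0%R, x]) (v y)%:E)%E; last first.
    by apply: eq_integral => y; rewrite inE/= in_itv/= => /andP[y0 _]; rewrite vE.
  rewrite -integral_reflect// [LHS]integral_mkcond [RHS]integral_mkcond.
  apply: eq_integral => y _; rewrite /= !patchE !mem_setE !in_itv/= andbT /u indicE.
  rewrite mem_setE in_itv/=.
  by case: (leP 0 y) => //= _; case: (leP y x) => //= _; rewrite ?mulr1 ?mulr0.
move=> <-; apply: eq_integral => w _; congr (expeR (- _)).
have cw := levy_cadlag hX w; have jw := levy_no_negative_jumps hX (w := w).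
have sw : (fun t => X t w) 0 = 0 := levy_start hX w.
rewrite (area_occupation cw jw sw h_meas h_ge0 (ltW x_gt0) alpha_ge0).
apply: eq_integral => s; rewrite inE/= in_itv/= andbT => s0; congr (_)%:E.
set l := regulator _ s; have l0 : 0 <= l by exact: regulator_ge0.
rewrite /u indicE mem_setE in_itv/= l0/=; case: (leP l x) => lx /=; last by rewrite mulr0.
have xl : 0 <= x - l by rewrite subr_ge0.
have q0 : 0 <= alpha * h (x - l) by rewrite mulr_ge0 ?h_ge0.
by rewrite mulr1 vE//; have [_ ->] := inv_spec _ q0.
Qed.
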